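(* Let $\mathcal{J}\subset\mathcal{L}$. Then the following statements are equivalent: (i) The set $\mathcal{J}$ is a homogeneous Hopf ideal of $\mathcal{L}$. (ii) There is a homogeneous semigroup congruence $\sim$ on $\mathbb{F}_d^{*0}$ such that $$\mathcal{J}=\overline{\mathrm{span}}^{w^*}\{L_u-L_v : u,v\in\mathbb{F}_d^{*0}\text{ with }u\sim v\}.$$
   Context: Let $d$ be a fixed positive integer, $\mathbb{F}_d^*$ the unital free semigroup on $\{1,\dots,d\}$ with identity $\varnothing$, $|w|$ the length of $w\in\mathbb{F}_d^*$, and $\mathbb{F}_d^{*0}$ the semigroup obtained from $\mathbb{F}_d^*$ by adjoining a zero element $0$ (length is defined only on $\mathbb{F}_d^*$). Let $\ell^2(\mathbb{F}_d^* )$ have orthonormal basis $\{\xi_w\}$ and put $L_u\xi_w=\xi_{uw}$ for $u,w\in\mathbb{F}_d^*$; conventions: $L_0:=0$, $L_\varnothing=I$. $\mathcal{L}=\mathcal{L}_d$ is the unital weak-operator-closed (WOT-closed) algebra generated by $\{L_u\}$; the weak* and WOT topologies coincide on it. It has a comultiplication $\Delta:\mathcal{L}\to\mathcal{L}\overline\otimes\mathcal{L}$, the unital weak*-continuous completely contractive homomorphism with $\Delta(L_w)=L_w\otimes L_w$ ($w\in\mathbb{F}_d^*$), where $\overline\otimes$ is the normal tensor product. An ideal means a WOT-closed two-sided ideal. A coideal is a weak*-closed subspace $\mathcal{J}$ with $\Delta(\mathcal{J})\subseteq\overline{\mathcal{J}\otimes\mathcal{L}+\mathcal{L}\otimes\mathcal{J}}^{w^*}$.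 A Hopf ideal is an ideal that is also a coideal. It is homogeneous if it is generated by homogeneous polynomials in $L_1,\dots,L_d$, equivalently is the weak*-closed span of the elements of the form $\sum_{|w|=n}a_wL_w$ that it contains. A semigroup congruence is an equivalence relation compatible with the semigroup operation. A semigroup congruence $\sim$ on $\mathbb{F}_d^{*0}$ is homogeneous if whenever $u\sim v$ with $u\not\sim0$ (and/or $v\not\sim0$), then $|u|=|v|$. *)

(* Defs.v *)
From HB Require Import structures.
From mathcomp Require Import all_boot all_order all_algebra finmap.
From mathcomp Require Import complex.
From mathcomp Require Import all_classical all_reals all_analysis.
From mathcomp Require Import ring.
From mathcomp.analysis.showcase Require summability.

Set Implicit Arguments.
Unset Strict Implicit.
Unset Printing Implicit Defensive.

Import Order.TTheory GRing.Theory Num.Theory.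
Import numFieldNormedType.Exports.

Local Open Scope classical_set_scope.
Local Open Scope ring_scope.

(* The complex numbers, as a normed space over themselves.  The order of [R[i]]
   is the partial order for which [x <= y] means that [y - x] is a nonnegative
   real. *)
Notation Cplx R := (R[i]^o).

(* Sums over an arbitrary index set: the limit along the net of finite
   subsets. *)
Notation csum := summability.sum.

Section l2.
Variables (R : realType) (X : choiceType).
Local Notation C := (Cplx R).

Definition square_summable : {pred X -> C} := fun f =>
  `[< exists M : R[i], forall F : {fset X}, \sum_(i <- F) `|f i| ^+ 2 <= M >].

Lemma square_summable_submod : submod_closed square_summable.
Proof.
split.
  by apply/asboolP; exists 0 => F; rewrite big1// => i _; rewrite normr0 expr0n.
move=> a f g /asboolP[M hM] /asboolP[N hN]; apply/asboolP.
exists (2 * (`|a| ^+ 2 * M + N)) => F.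
have key i : `|(a *: f + g) i| ^+ 2 <= 2 * (`|a| ^+ 2 * `|f i| ^+ 2 + `|g i| ^+ 2).
  have h (x y : R[i]) : `|x + y| ^+ 2 <= 2 * (`|x| ^+ 2 + `|y| ^+ 2).
    apply: (@le_trans _ _ ((`|x| + `|y|) ^+ 2)).
      by rewrite lerXn2r ?nnegrE ?addr_ge0// ler_normD.
    rewrite -subr_ge0.
    have -> : 2 * (`|x| ^+ 2 + `|y| ^+ 2) - (`|x| + `|y|) ^+ 2
              = (`|x| - `|y|) ^+ 2.
      by rewrite sqrrD sqrrB mulr2n mulrDl mul1r mulr2n !opprD !addrA; ring.
    by apply: real_exprn_even_ge0 => //; apply: rpredB; exact: normr_real.
  by have := h (a * f i) (g i); rewrite normrM exprMn.
apply: le_trans (ler_sum _ (fun i _ => key i)) _.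
rewrite -mulr_sumr ler_wpM2l// big_split/= lerD// -mulr_sumr.
by rewrite ler_wpM2l// exprn_ge0.
Qed.

HB.instance Definition _ :=
  GRing.isSubmodClosed.Build _ _ square_summable square_summable_submod.

Record l2 := L2 { l2fun :> X -> C ; l2P : l2fun \in square_summable }.

HB.instance Definition _ := [isSub for l2fun].
HB.instance Definition _ := [Choice of l2 by <:].
HB.instance Definition _ := [SubChoice_isSubLmodule of l2 by <:].

Definition dotl2 (f g : l2) : C := csum (fun x => f x * (g x)^* : C).

Definition sqnorm (f : l2) : C := dotl2 f f.

Lemma basis_subproof (x : X) : (fun y => (y == x)%:R : C) \in square_summable.
Proof.
apply/asboolP; exists 1 => F.
rewrite (eq_bigr (fun y => (y == x)%:R)); last first.
  by move=> y _; case: (y == x); rewrite ?normr1 ?normr0 ?expr1n ?expr0n.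
have [xF|xF] := boolP (x \in F).
  rewrite (big_fsetD1 x)//= eqxx big1_fset ?addr0// => y.
  by rewrite in_fsetD1 => /andP[/negbTE ->].
rewrite big1_fset// => y yF _; case: eqP => // yx; by rewrite -yx yF in xF.
Qed.

Definition basisv (x : X) : l2 := L2 (basis_subproof x).

(* Operators are plain functions, so that they carry the pointwise vector space
   structure; boundedness is a separate predicate. *)
Definition op := l2 -> l2.

HB.instance Definition _ := GRing.Lmodule.on op.

Definition bounded_op : set op := [set T | linear T /\
  exists2 c : R[i], 0 <= c & forall f, sqnorm (T f) <= c * sqnorm f].

Definition linear_subspace (V : set op) : Prop :=
  V 0 /\ forall (a : R[i]) S T, V S -> V T -> V (a *: S + T).

Definition linear_span (S : set op) : set op :=
  [set T | forall V, linear_subspace V -> S `<=` V -> V T].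

(* The weak operator topology is the initial topology for the functionals
   [T |-> <T f, g>]. *)
Definition wot_eval (T : op) : {ptws l2 * l2 -> C} :=
  fun p => dotl2 (T p.1) p.2.

Definition wot : Type := initial_topology wot_eval.

(* The weak* topology, coming from the duality with the trace class operators:
   the initial topology for the functionals [T |-> \sum_n <T f_n, g_n>] where
   [\sum_n ||f_n||^2] and [\sum_n ||g_n||^2] are finite. *)
Definition sqsummable_seq (f : nat -> l2) : Prop :=
  exists M : R[i], forall n, \sum_(k < n) sqnorm (f k) <= M.

Definition wstar_index : Type :=
  {p : (nat -> l2) * (nat -> l2) | sqsummable_seq p.1 /\ sqsummable_seq p.2}.

Definition wstar_eval (T : op) : {ptws wstar_index -> C} :=
  fun p => csum (fun n => dotl2 (T ((sval p).1 n)) ((sval p).2 n)).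

Definition wstar : Type := initial_topology wstar_eval.

(* Closures are taken inside the bounded operators. *)
Definition wot_closure (S : set op) : set op :=
  bounded_op `&` closure (S : set wot).

Definition wstar_closure (S : set op) : set op :=
  bounded_op `&` closure (S : set wstar).

Definition unital_subalgebra (A : set op) : Prop :=
  [/\ A `<=` bounded_op, linear_subspace A, A idfun
    & forall S T, A S -> A T -> A (S \o T)].

Definition wot_algebra (S : set op) : set op :=
  [set T | forall A, unital_subalgebra A -> wot_closure A `<=` A ->
     S `<=` A -> A T].

(* The operator matrix [A], acting on the direct sum of [n] copies of [l2], has
   norm at most [sqrt c]. *)
Definition opmx_bounded n (A : 'I_n -> 'I_n -> op) (c : R[i]) : Prop :=
  forall f : 'I_n -> l2,
    \sum_i sqnorm (\sum_j A i j (f j)) <= c * \sum_j sqnorm (f j).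

End l2.

Section tensor.
Variables (R : realType) (X Y : choiceType).
Local Notation C := (Cplx R).

Lemma tensv_subproof (f : l2 R X) (g : l2 R Y) :
  (fun p : X * Y => f p.1 * g p.2 : C) \in @square_summable R (X * Y)%type.
Proof.
have /asboolP[M hM] := l2P f; have /asboolP[N hN] := l2P g.
apply/asboolP; exists (M * N) => F.
pose F1 := [fset p.1 | p in F]%fset; pose F2 := [fset p.2 | p in F]%fset.
pose s := [seq p <- [seq (x, y) | x <- F1, y <- F2] | p \in F].
have Fs : perm_eq F s.
  apply: uniq_perm; first exact: fset_uniq.
    by rewrite filter_uniq// allpairs_uniq ?fset_uniq// => -[? ?] [? ?].
  move=> [x y]; rewrite mem_filter; apply/idP/andP => [h|[]//]; split=> //.
  apply/allpairsP; exists (x, y); split => //=.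
    by apply/imfsetP; exists (x, y).
  by apply/imfsetP; exists (x, y).
rewrite (perm_big _ Fs)/= big_filter big_mkcond/= big_allpairs/=.
apply: (@le_trans _ _ (\sum_(x <- F1) \sum_(y <- F2) `|f x| ^+ 2 * `|g y| ^+ 2)).
  apply: ler_sum => x _; apply: ler_sum => y _.
  by case: ifP => _; rewrite ?normrM ?exprMn// mulr_ge0// exprn_ge0.
under eq_bigr do rewrite -mulr_sumr.
rewrite -mulr_suml; apply: ler_pM => //; apply: sumr_ge0 => i _;
  exact: exprn_ge0.
Qed.

Definition tensv (f : l2 R X) (g : l2 R Y) : l2 R (X * Y)%type :=
  L2 (tensv_subproof f g).

(* [T] is [A (x) B], under the identification of [l2 X (x) l2 Y] with
   [l2 (X * Y)]; a bounded [T] is determined by this. *)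
Definition is_tensor (A : op R X) (B : op R Y) (T : op R (X * Y)%type) : Prop :=
  bounded_op T /\ forall f g, T (tensv f g) = tensv (A f) (B g).

Definition alg_tensor (S1 : set (op R X)) (S2 : set (op R Y)) :
    set (op R (X * Y)%type) :=
  linear_span [set T | exists A B, [/\ S1 A, S2 B & is_tensor A B T]].

Definition normal_tensor (S1 : set (op R X)) (S2 : set (op R Y)) :
    set (op R (X * Y)%type) :=
  wstar_closure (alg_tensor S1 S2).

End tensor.

(* The free semigroup on d letters, and its version with a zero [None]. *)
Notation word d := (seq 'I_d).
Notation word0 d := (option (word d)).

Section free_semigroup_algebra.
Variables (R : realType) (d : nat).
Local Notation C := (Cplx R).

Local Notation word := (word d).
Local Notation word0 := (word0 d).

Definition mulw0 (u v : word0) : word0 :=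
  if (u, v) is (Some u', Some v') then Some (u' ++ v') else None.

Local Notation H := (l2 R word).
Local Notation BH := (op R word).
Local Notation BHH := (op R (word * word)%type).

Lemma creation_subproof (u : word) (f : H) :
  (fun w : word => if prefix u w then f (drop (size u) w) else 0 : C)
    \in @square_summable R word.
Proof.
have /asboolP[M hM] := l2P f; apply/asboolP; exists M => F.
pose s := [seq drop (size u) w | w <- F & prefix u w].
have us : uniq s.
  rewrite map_inj_in_uniq ?filter_uniq ?fset_uniq// => x y.
  rewrite !mem_filter => /andP[/prefixP[x' ->] _] /andP[/prefixP[y' ->] _].
  by rewrite !drop_size_cat// => ->.
apply: le_trans (hM [fset x in s]%fset).
have Es : perm_eq [fset x in s]%fset s.
  by apply: uniq_perm => //= x; rewrite !inE.
rewrite (perm_big _ Es)/= big_map big_filter [leRHS]big_mkcond; apply: ler_sum => w _.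
by case: ifP => //; rewrite normr0 expr0n.
Qed.

Definition creation (u : word) : BH := fun f => L2 (creation_subproof u f).

Lemma creation_basis (u w : word) :
  creation u (basisv R w) = basisv R (u ++ w : word).
Proof.
apply/val_inj/funext => v /=; case: ifPn => [/prefixP[v' ->]|nuv].
  by rewrite drop_size_cat// eqseq_cat// eqxx.
by case: eqP => // vE; rewrite vE prefix_prefix in nuv.
Qed.

Definition creation0 (u : word0) : BH := if u is Some w then creation w else 0.

Definition free_algebra : set BH := wot_algebra (range creation).
Local Notation L := free_algebra.

Definition completely_contractive_on (A : set BH) (Delta : BH -> BHH) : Prop :=
  forall n (T : 'I_n -> 'I_n -> BH) (c : R[i]), (forall i j, A (T i j)) ->
    0 <= c -> opmx_bounded T c -> opmx_bounded (fun i j => Delta (T i j)) c.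

(* The unital weak*-continuous completely contractive homomorphism from [L] to
   its normal tensor square that maps [L_w] to [L_w (x) L_w]; it is determined
   on [L] by these properties, and its values outside [L] are irrelevant. *)
Definition comultiplication (Delta : BH -> BHH) : Prop :=
  [/\ (forall T, L T -> normal_tensor L L (Delta T)),
      [/\ Delta idfun = idfun,
          (forall (a : R[i]) S T, L S -> L T ->
             Delta (a *: S + T) = a *: Delta S + Delta T)
        & (forall S T, L S -> L T -> Delta (S \o T) = Delta S \o Delta T)],
      {within (L : set (wstar R word)),
         continuous (Delta : wstar R word -> wstar R (word * word)%type)},
      completely_contractive_on L Delta
    & forall w, is_tensor (creation w) (creation w) (Delta (creation w))].

Definition ideal (J : set BH) : Prop :=
  [/\ J `<=` L, linear_subspace J,
      (forall A T, L A -> J T -> J (A \o T) /\ J (T \o A))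
    & wot_closure J `<=` J].

Definition coideal (Delta : BH -> BHH) (J : set BH) : Prop :=
  [/\ J `<=` L, linear_subspace J, wstar_closure J `<=` J
    & forall T, J T -> wstar_closure
        [set S1 + S2 | S1 in alg_tensor J L & S2 in alg_tensor L J] (Delta T)].

Definition hopf_ideal (Delta : BH -> BHH) (J : set BH) : Prop :=
  ideal J /\ coideal Delta J.

Definition ideal_generated (S : set BH) : set BH :=
  [set T | forall J, ideal J -> S `<=` J -> J T].

(* All terms of the polynomial are words of the same length [n]; the zero
   polynomial is included. *)
Definition homogeneous_poly (T : BH) : Prop :=
  exists n (a : n.-tuple 'I_d -> R[i]),
    T = \sum_(w : n.-tuple 'I_d) a w *: creation (tval w).

Definition homogeneous (J : set BH) : Prop :=
  exists2 S : set BH, S `<=` homogeneous_poly & J = ideal_generated S.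

Definition semigroup_congruence (sim : word0 -> word0 -> Prop) : Prop :=
  RelationClasses.Equivalence sim /\
  forall u u' v v', sim u u' -> sim v v' -> sim (mulw0 u v) (mulw0 u' v').

Definition homogeneous_congruence (sim : word0 -> word0 -> Prop) : Prop :=
  semigroup_congruence sim /\
  forall u v : word, sim (Some u) (Some v) ->
    ~ sim (Some u) None \/ ~ sim (Some v) None -> size u = size v.

End free_semigroup_algebra.

Arguments free_algebra : clear implicits.

(* Main.v *)
Require Import Defs.
From mathcomp Require Import all_boot all_order all_algebra finmap.
From mathcomp Require Import complex.
From mathcomp Require Import all_classical all_reals all_analysis.
From mathcomp Require Import ring zify.
From mathcomp.analysis.showcase Require summability.

(** Write [L_w] for [creation w].  Every element [T] of the free semigroup algebra
    has Fourier coefficients [fcoef T w], the coordinates of its value on the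
    basis vector of the empty word, and homogeneous components [component n T].
    Two facts reduce the theorem to finite-dimensional algebra in each degree.

    First, [T] is a weak* limit of its Fejer means
    ([free_algebra_wstar_span_component]).  These means are averages of
    compressions of [T] to windows of consecutive degrees ([fejer_window]),
    which bounds their norms by that of [T] ([fejer_bound]); they converge
    coordinatewise, and for bounded sequences this implies weak* convergence
    ([bounded_cvg_wstar]).  Second, coefficients are weakly continuous, and they
    multiply by a finite convolution ([free_algebra_convolution],
    [component_comp]).

    From a congruence to an ideal.  In degree [n], the span of the differences
    [L_u - L_v] of congruent words is the set of polynomials whose coefficients
    sum to zero over each class other than that of zero
    ([class_sum_span], [span_of_class_sums]).  Hence the weak* closed span is the
    set [graded_span] of those [T] in the algebra whose components all lie in the
    span of the differences; it is a weakly closed homogeneous ideal.  It is a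
    coideal because
    [L_u (x) L_u - L_v (x) L_v = (L_u - L_v) (x) L_u + L_v (x) (L_u - L_v)].

    From a Hopf ideal [J] to a congruence.  Let [u] and [v] be related when
    [L_u - L_v] is in [J].  This is a congruence since [J] is an ideal, and a
    homogeneous one since [J] contains the components of its elements
    ([homogeneous_ideal_component]).  The coideal property says that the functions
    on words of length [n] that annihilate [J] are closed under the pointwise
    product ([annihilator_mul]).  A subalgebra of the functions on a finite set is
    spanned by indicators of disjoint sets, and here these sets are the classes of
    words other than that of zero ([annihilator_indicator]).  So the class sums of
    the elements of [J] vanish, their components lie in the span of the
    differences, and the Fejer means conclude. *)

Set Implicit Arguments.
Unset Strict Implicit.
Unset Printing Implicit Defensive.

Import Order.TTheory GRing.Theory Num.Theory.
Import numFieldNormedType.Exports.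

Local Open Scope classical_set_scope.
Local Open Scope ring_scope.

(** * Initial topologies for families of functionals *)
Section initial.
Variables (I : Type) (V : choiceType) (K : topologicalType).
Variable ev : V -> {ptws I -> K}.
Local Notation W := (initial_topology ev).

(** Together with the next two lemmas this reduces every topological question
    about the two operator topologies to scalar convergence of their defining
    functionals. *)
Lemma cvg_initial_ptws (F : set_system V) (FF : Filter F) (x : V) :
  (forall i, ev T i @[T --> F] --> ev x i) -> F --> (x : W).
Proof.
move=> h A /= [_ [[B Bop <-] Bx sBA]].
suff : (ev @ F) --> (ev x : {ptws I -> K}).
  move=> /(_ B) FB; apply: filterS sBA _; apply: FB.
  by exact: open_nbhs_nbhs.
apply/cvg_sup => i U [_ [[C oC <-] Cx sCU]].
apply: (filterS sCU); exact: (h i C (open_nbhs_nbhs (conj oC Cx))).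
Qed.

Lemma continuous_initial_ptws (i : I) : continuous (fun T : W => ev T i).
Proof.
move=> T; apply: (@continuous_comp W {ptws I -> K} K ev (fun h => h i)).
  exact: initial_continuous.
have /cvg_sup/(_ i) h : nbhs (ev T : {ptws I -> K}) --> (ev T : {ptws I -> K}) by exact: cvg_id.
apply: cvg_trans (@initial_continuous {ptws I -> K} K (fun h => h i) (ev T)).
exact: cvg_app h.
Qed.

Lemma closure_initial_cvg (S : set V) (u : nat -> V) (x : V) :
  (forall n, S (u n)) -> (forall i, (fun n => ev (u n) i) @ \oo --> ev x i) ->
  closure (S : set W) (x : W).
Proof.
move=> Su ux; have : u @ \oo --> (x : W).
  by apply: cvg_initial_ptws => i; apply: ux.
move=> cu A Ax; have [n _ h] := cu A Ax.
by exists (u n); split => //; apply: h => /=.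
Qed.

End initial.

Lemma closure_image (V W : topologicalType) (f : V -> W) (S : set V) (S' : set W) (x : V) :
  f @ x --> f x -> (forall y, S y -> S' (f y)) -> closure S x -> closure S' (f x).
Proof.
move=> cf sS cS B /cf fB; have [y [Sy By]] := cS _ fB.
by exists (f y); split; [apply: sS|].
Qed.

(** * Absolutely convergent sums over an index set *)
Notation totally := summability.totally.

#[global] Instance totally_proper (I : choiceType) : ProperFilter (@totally I) :=
  summability.totally_filter.

#[global] Instance totally_filter (I : choiceType) : Filter (@totally I) :=
  _.

Section csum.
Variables (R : realType) (X : choiceType).
Local Notation C := (Cplx R).
Implicit Types (z w : X -> C) (F : {fset X}).

Definition abs_summable z :=
  exists M : R[i], forall F, \sum_(i <- F) `|z i| <= M.

Lemma partial_sumE z F : summability.partial_sum z F = \sum_(i <- F) z i.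
Proof. by rewrite big_seq_fsetE. Qed.

Lemma fset_sum_le (h : X -> R[i]) F F' : (forall i, 0 <= h i) ->
  (F `<=` F')%fset -> \sum_(i <- F) h i <= \sum_(i <- F') h i.
Proof.
move=> h0 FF'; rewrite [leRHS](big_fsetID _ (mem F))/=.
rewrite (_ : [fset x | x in F' & x \in F]%fset = F); last first.
  apply/fsetP => x; rewrite !inE/= andbC; case: (boolP (x \in F)) => //= xF.
  by rewrite (fsubsetP FF').
by rewrite lerDl sumr_ge0.
Qed.

(** Monotone convergence along the net of finite subsets.  The supremum is
    taken over the real parts, since [R[i]] is only partially ordered; both
    halves of the conclusion are used, the second to control tails. *)
Lemma nneg_net (h : X -> R[i]) (M : R[i]) : (forall i, 0 <= h i) ->
  (forall F, \sum_(i <- F) h i <= M) ->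
  exists2 s : R[i], (forall F, \sum_(i <- F) h i <= s) &
    forall e, 0 < e -> exists F, forall F', (F `<=` F')%fset ->
      s - e < \sum_(i <- F') h i.
Proof.
move=> h0 hM; pose S F := \sum_(i <- F) h i.
have S0 F : 0 <= S F by exact: sumr_ge0.
have SE F : S F = (complex.Re (S F))%:C%C by rewrite RRe_real ?ger0_real.
pose A := [set complex.Re (S F) | F in [set: {fset X}]].
have hA : has_sup A.
  split; first by exists (complex.Re (S fset0)), fset0.
  exists (complex.Re M) => _ [F _ <-].
  by have := hM F; rewrite lecE => /andP[].
exists (sup A)%:C%C.
  move=> F; rewrite -/(S F) SE lecR; apply: sup_upper_bound => //; by exists F.
move=> e e0; have eE : e = (complex.Re e)%:C%C by rewrite RRe_real ?gtr0_real.
move: e0; rewrite eE (ltcR 0) => e0.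
have [_ [F _ <-] hF] := sup_adherent e0 hA.
exists F => F' FF'; apply: (@lt_le_trans _ _ (S F)); last exact: fset_sum_le.
by rewrite SE -rmorphB ltcR.
Qed.

Lemma normc_ge_Im (x : R[i]) : `|complex.Im x|%:C%C <= `|x|.
Proof.
have := normc_ge_Re (x * 'i%C); rewrite ReiNIm normrN => /le_trans; apply.
by rewrite normrM [X in _ * X]normc_def /= expr0n expr1n add0r sqrtr1 mulr1.
Qed.

Lemma nneg_cvg (h : X -> C) (M : R[i]) : (forall i, 0 <= (h i : R[i])) ->
  (forall F, \sum_(i <- F) (h i : R[i]) <= M) ->
  exists2 s : C, (forall F, \sum_(i <- F) (h i : R[i]) <= s) &
    summability.partial_sum h @ totally --> s.
Proof.
move=> h0 hM; have [s s1 s2] := nneg_net h0 hM; exists s => //.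
apply/cvgrPdist_lt => e e0; have [F hF] := s2 _ e0.
exists F => //= F' FF'; rewrite partial_sumE.
by rewrite ger0_norm ?subr_ge0 ?s1// ltrBlDr -ltrBlDl hF.
Qed.

Lemma nneg_tail (h : X -> R[i]) (M : R[i]) : (forall i, 0 <= h i) ->
  (forall F, \sum_(i <- F) h i <= M) ->
  forall e, 0 < e -> exists G : {fset X}, forall F,
    \sum_(i <- F | i \notin G) h i <= e.
Proof.
move=> h0 hM e e0; have [s s1 s2] := nneg_net h0 hM; have [G hG] := s2 _ e0.
exists G => F; have := s1 (G `|` F)%fset.
have := hG _ (fsubset_refl G); rewrite ltrBlDr => /[swap] /le_lt_trans /[apply].
rewrite (big_fsetID _ (mem G))/= (_ : [fset x | x in (G `|` F) & x \in G]%fset = G); last first.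
  apply/fsetP => x; rewrite !inE/= andbC; by case: (boolP (x \in G)).
rewrite ltrD2l => /ltW; apply: le_trans.
rewrite [leRHS]big_fset_condE/= [leLHS]big_fset_condE/=.
apply: fset_sum_le => //; apply/fsubsetP => x; rewrite !inE/= => /andP[-> ->].
by rewrite orbT.
Qed.

(** The real and imaginary parts of [z] are differences of the nonnegative
    families [|z| + Re z], [|z| + Im z] and [|z|], to which monotone convergence
    applies. *)
Lemma abs_summable_cvg z : abs_summable z ->
  summability.partial_sum z @ totally --> (csum z : C).
Proof.
move=> [M hM].
suff [s cs] : exists s : C, summability.partial_sum z @ totally --> s.
  by rewrite /csum (norm_cvg_lim cs).
have nz0 i : 0 <= (`|z i| : R[i]) by [].
have ReP i : 0 <= `|z i| + (complex.Re (z i))%:C%C :> R[i].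
  rewrite -lerBlDr sub0r -rmorphN; apply: le_trans (normc_ge_Re _).
  by rewrite lecR -normrN ler_norm.
have ImP i : 0 <= `|z i| + (complex.Im (z i))%:C%C :> R[i].
  rewrite -lerBlDr sub0r -rmorphN; apply: le_trans (normc_ge_Im _).
  by rewrite lecR -normrN ler_norm.
have bd (p : R[i] -> R) : (forall x, `|p x|%:C%C <= `|x|) ->
    forall F, \sum_(i <- F) (`|z i| + (p (z i))%:C%C) <= M + M :> R[i].
  move=> pP F; rewrite big_split/= lerD//; apply: le_trans (hM F).
  by apply: ler_sum => i _; apply: le_trans (pP _); rewrite lecR ler_norm.
have [s0 _ c0] := @nneg_cvg (fun i => `|z i|) M nz0 hM.
have [s1 _ c1] := nneg_cvg ReP (bd _ (@normc_ge_Re R)).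
have [s2 _ c2] := nneg_cvg ImP (bd _ normc_ge_Im).
exists ((s1 - s0) + 'i%C *: (s2 - s0)).
have -> : summability.partial_sum z = (fun F =>
    (summability.partial_sum (fun i => `|z i| + (complex.Re (z i))%:C%C : C) F
      - summability.partial_sum (fun i => `|z i| : C) F)
    + 'i%C *: (summability.partial_sum (fun i => `|z i| + (complex.Im (z i))%:C%C : C) F
      - summability.partial_sum (fun i => `|z i| : C) F) : C).
  apply/funext => F; rewrite !partial_sumE !big_split/= !(addrC (\sum_(i <- F) `|_|)) !addrK.
  rewrite scaler_sumr -big_split/=; apply: eq_bigr => i _.
  have hz := complexE (z i : R[i]); rewrite [LHS]hz.
  by [].
exact: cvgD (cvgB c1 c0) (cvgZl_tmp (cvgB c2 c0)).
Qed.

Lemma csum_le z (M : R[i]) : abs_summable z ->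
  (forall F, `|\sum_(i <- F) z i| <= M) -> `|csum z| <= M.
Proof.
move=> sz hM; have cz := abs_summable_cvg sz.
have M0 : 0 <= M by apply: le_trans (hM fset0).
rewrite real_leNgt ?ger0_real//; apply/negP => Mlt.
move/cvgrPdist_lt: cz => /(_ (`|csum z| - M)).
rewrite subr_gt0 => /(_ Mlt)[F _ /(_ F)]; rewrite /= fsubset_refl => /(_ isT).
rewrite partial_sumE => h.
suff : `|csum z| < `|csum z| by rewrite ltxx.
rewrite -{1}(subrK (\sum_(i <- F) z i) (csum z)).
apply: le_lt_trans (ler_normD _ _) _.
by rewrite -[ltRHS](subrK M) ltr_leD.
Qed.

Lemma csum_ge (h : X -> C) (M : R[i]) : (forall i, 0 <= (h i : R[i])) ->
  (forall F, \sum_(i <- F) (h i : R[i]) <= M) ->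
  forall F, \sum_(i <- F) (h i : R[i]) <= csum h.
Proof.
move=> h0 hM F; have [s s1 s2] := nneg_cvg h0 hM.
by rewrite /csum (norm_cvg_lim s2).
Qed.

Lemma csumD (a : R[i]) z w : abs_summable z -> abs_summable w ->
  csum (fun i => a * z i + w i : C) = a * csum z + csum w.
Proof.
move=> sz sw; apply: norm_cvg_lim.
have -> : summability.partial_sum (fun i => a * z i + w i : C) =
   (fun F => a *: summability.partial_sum z F + summability.partial_sum w F).
  apply/funext => F; rewrite !partial_sumE big_split/= -mulr_sumr//.
apply: cvgD; last exact: abs_summable_cvg.
by apply: cvgZl_tmp; exact: abs_summable_cvg.
Qed.

Lemma csum_sum (I : Type) (r : seq I) (z : I -> X -> C) :
  (forall k, abs_summable (z k)) ->
  abs_summable (fun i => \sum_(k <- r) z k i) /\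
  csum (fun i => \sum_(k <- r) z k i : C) = \sum_(k <- r) csum (z k).
Proof.
move=> sz; elim: r => [|k r [[M hM] IH]].
  have s0 : abs_summable (fun i : X => \sum_(k <- [::]) z k i).
    by exists 0 => F; rewrite big1// => i _; rewrite big_nil normr0.
  split=> //; apply/eqP; rewrite big_nil -normr_le0; apply: csum_le s0 _ => F.
  by rewrite big1 ?normr0// => i _; rewrite big_nil.
have [N hN] := sz k; split.
  exists (N + M) => F; apply: le_trans (lerD (hN F) (hM F)).
  by rewrite -big_split/=; apply: ler_sum => i _; rewrite big_cons ler_normD.
rewrite big_cons -IH -[csum (z k)]mul1r -csumD//; last by exists M.
by congr csum; apply/funext => i; rewrite big_cons mul1r.
Qed.

End csum.

(** * Norm and inner product of square summable families *)
Section l2_geometry.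
Variables (R : realType) (X : choiceType).
Local Notation C := (Cplx R).
Local Notation H := (l2 R X).
Implicit Types (f g h : H) (F : {fset X}) (M : R[i]).

Lemma l2_ext f g : (forall x, f x = g x) -> f = g.
Proof. by move=> fg; apply/val_inj/funext. Qed.

Lemma l2DE f g x : (f + g) x = f x + g x. Proof. by []. Qed.
Lemma l2ZE (a : R[i]) f x : (a *: f) x = a * f x. Proof. by []. Qed.
Lemma l20E x : (0 : H) x = 0. Proof. by []. Qed.
Lemma l2NE f x : (- f) x = - f x. Proof. by []. Qed.
Lemma l2sumE (I : Type) (r : seq I) (P : pred I) (u : I -> H) x :
  (\sum_(i <- r | P i) u i) x = \sum_(i <- r | P i) u i x.
Proof. by elim/big_rec2: _ => // i a b _ <-. Qed.

Lemma basisvE (x y : X) : basisv R x y = (y == x)%:R. Proof. by []. Qed.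

(** Wherever Cauchy-Schwarz for infinite sums would be natural, this cruder
    bound suffices, because the constants are irrelevant or a weight can be
    introduced. *)
Lemma normM_le_sqrD (a b : R[i]) : `|a| * `|b| <= `|a| ^+ 2 + `|b| ^+ 2.
Proof.
have ab0 : 0 <= `|a| * `|b| by rewrite mulr_ge0.
have h : 0 <= (`|a| - `|b|) ^+ 2.
  by apply: real_exprn_even_ge0 => //; apply: rpredB; exact: normr_real.
apply: le_trans (_ : `|a| * `|b| *+ 2 <= _); first by rewrite mulr2n lerDl.
by rewrite -subr_ge0; move: h; rewrite sqrrB addrAC.
Qed.

Lemma square_sum_bound f : exists M, forall F, \sum_(i <- F) `|f i| ^+ 2 <= M.
Proof. by have /asboolP := l2P f. Qed.

Lemma dotl2_summable f g : abs_summable (fun x => f x * (g x)^* : C).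
Proof.
have [M hM] := square_sum_bound f; have [N hN] := square_sum_bound g.
exists (M + N) => F; apply: le_trans (lerD (hM F) (hN F)).
rewrite -big_split/=; apply: ler_sum => i _.
by rewrite normrM norm_conjC normM_le_sqrD.
Qed.

Lemma sqnorm_ge f F : \sum_(i <- F) `|f i| ^+ 2 <= sqnorm f.
Proof.
have [M hM] := square_sum_bound f.
have -> : sqnorm f = csum (fun x => `|f x| ^+ 2 : C).
  by congr csum; apply/funext => x; rewrite normCK.
by apply: (@csum_ge R X (fun x => `|f x| ^+ 2) M) => // i; exact: exprn_ge0.
Qed.

Lemma sqnorm_ge0 f : 0 <= sqnorm f.
Proof. by have := sqnorm_ge f fset0; rewrite big_seq_fset0. Qed.

Lemma sqnorm_le f M : (forall F, \sum_(i <- F) `|f i| ^+ 2 <= M) -> sqnorm f <= M.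
Proof.
move=> hM; rewrite -[sqnorm f]ger0_norm ?sqnorm_ge0//.
apply: csum_le (dotl2_summable f f) _ => F.
rewrite (eq_bigr (fun i => `|f i| ^+ 2)); last by move=> i _; rewrite normCK.
by rewrite ger0_norm// sumr_ge0// => i _; exact: exprn_ge0.
Qed.

Lemma coord_le f x : `|f x| ^+ 2 <= sqnorm f.
Proof. by have := sqnorm_ge f [fset x]%fset; rewrite big_seq_fset1. Qed.

Lemma dotl2_le f g M :
  (forall F, `|\sum_(i <- F) f i * (g i)^*| <= M) -> `|dotl2 f g| <= M.
Proof. exact/csum_le/dotl2_summable. Qed.

Lemma dotl2Dl (a : R[i]) f g h : dotl2 (a *: f + g) h = a * dotl2 f h + dotl2 g h.
Proof.
rewrite -csumD; [|exact: dotl2_summable..].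
by congr csum; apply/funext => x; rewrite l2DE l2ZE mulrDl mulrA.
Qed.

Lemma dotl2_basis f x : dotl2 f (basisv R x) = f x.
Proof.
apply: norm_cvg_lim; apply: cvg_near_cst; exists [fset x]%fset => // F /= /fsubsetP xF.
rewrite partial_sumE (big_fsetD1 x)//= ?xF ?inE// eqxx conjC1 mulr1.
rewrite big1_fset ?addr0// => y.
by rewrite in_fsetD1 => /andP[/negbTE -> _ _]; rewrite conjC0 mulr0.
Qed.

Lemma sqr_normD_le (a b : R[i]) : `|a + b| ^+ 2 <= 2 * (`|a| ^+ 2 + `|b| ^+ 2).
Proof.
apply: (@le_trans _ _ ((`|a| + `|b|) ^+ 2)).
  by rewrite lerXn2r ?nnegrE ?addr_ge0// ler_normD.
rewrite -subr_ge0.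
have -> : 2 * (`|a| ^+ 2 + `|b| ^+ 2) - (`|a| + `|b|) ^+ 2 = (`|a| - `|b|) ^+ 2.
  by ring.
by apply: real_exprn_even_ge0 => //; apply: rpredB; exact: normr_real.
Qed.

Lemma sqnormD f g : sqnorm (f + g) <= 2 * (sqnorm f + sqnorm g).
Proof.
apply: sqnorm_le => F.
apply: (@le_trans _ _ (\sum_(i <- F) 2 * (`|f i| ^+ 2 + `|g i| ^+ 2))).
  by apply: ler_sum => i _; exact: sqr_normD_le.
by rewrite -mulr_sumr ler_wpM2l// big_split/= lerD ?sqnorm_ge.
Qed.

Lemma sqnormZ (a : R[i]) f : sqnorm (a *: f) <= `|a| ^+ 2 * sqnorm f.
Proof.
apply: sqnorm_le => F.
rewrite (eq_bigr (fun i => `|a| ^+ 2 * `|f i| ^+ 2)); last first.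
  by move=> i _; rewrite l2ZE normrM exprMn.
by rewrite -mulr_sumr ler_wpM2l ?exprn_ge0 ?sqnorm_ge.
Qed.

(** Squared norms are suprema over finite subsets, and here a finite sum of
    such suprema is bounded by bounding the sums over one common finite
    subset. *)
Lemma sum_sqnorm_le (I : Type) (r : seq I) (u : I -> H) M :
  (forall F, \sum_(k <- r) \sum_(i <- F) `|u k i| ^+ 2 <= M) ->
  \sum_(k <- r) sqnorm (u k) <= M.
Proof.
move=> hM; have [su <-] := csum_sum r (fun k => dotl2_summable (u k) (u k)).
apply: le_trans (real_ler_norm _) _; last first.
  apply: csum_le su _ => F; apply: le_trans (hM F).
  rewrite exchange_big/=; apply: le_trans (ler_norm_sum _ _ _) _.
  apply: ler_sum => k _; apply: le_trans (ler_norm_sum _ _ _) _.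
  by apply: ler_sum => i _; rewrite -normCK normrX normr_id.
have [_ ->] := csum_sum r (fun k => dotl2_summable (u k) (u k)).
by apply: ger0_real; apply: sumr_ge0 => k _; exact: sqnorm_ge0.
Qed.

Definition trunc F f : H := \sum_(x <- F) f x *: basisv R x.

Lemma truncE F f x : trunc F f x = if x \in F then f x else 0.
Proof.
rewrite l2sumE; case: ifPn => xF.
  rewrite (big_fsetD1 x)// l2ZE basisvE eqxx mulr1.
  rewrite big1_fset => [|y]; first exact: addr0.
  by rewrite in_fsetD1 eq_sym => /andP[/negbTE yx _ _]; rewrite l2ZE basisvE yx mulr0.
rewrite big1_fset// => y yF _; rewrite l2ZE basisvE.
by case: eqP xF => [->|_ _]; [rewrite yF|rewrite mulr0].
Qed.

Lemma trunc_approx f e : 0 < e -> exists F, sqnorm (f - trunc F f) <= e.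
Proof.
move=> e0; have [M hM] := square_sum_bound f.
have [|G hG] := nneg_tail _ hM e0; first by move=> i; exact: exprn_ge0.
exists G; apply: sqnorm_le => F; apply: le_trans (hG F).
rewrite [leRHS]big_mkcond; apply: ler_sum => i _; rewrite l2DE l2NE truncE.
by case: (i \in G) => /=; rewrite ?subrr ?normr0 ?expr0n//= subr0.
Qed.

End l2_geometry.

(** * Bounded operators and their weak closures *)
Section operators.
Variables (R : realType) (X : choiceType).
Local Notation C := (Cplx R).
Local Notation H := (l2 R X).
Local Notation B := (op R X).
Implicit Types (f g : H) (S T : B).

Lemma opDE S T f : (S + T) f = S f + T f. Proof. by []. Qed.
Lemma opZE (a : R[i]) T f : (a *: T) f = a *: T f. Proof. by []. Qed.
Lemma opNE T f : (- T) f = - T f. Proof. by []. Qed.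
Lemma op0E f : (0 : B) f = 0. Proof. by []. Qed.
Lemma opsumE (I : Type) (r : seq I) (P : pred I) (u : I -> B) f :
  (\sum_(i <- r | P i) u i) f = \sum_(i <- r | P i) u i f.
Proof. by elim/big_rec2: _ => // i a b _ <-. Qed.

Lemma bounded_opP T (a : R[i]) f g : bounded_op T ->
  T (a *: f + g) = a *: T f + T g.
Proof. by case=> lT _; rewrite lT. Qed.

Lemma bounded_op_0 T : bounded_op T -> T 0 = 0.
Proof. by move=> /(bounded_opP (-1) 0 0); rewrite scaler0 addr0 scaleN1r addNr. Qed.

Lemma bounded_opD T f g : bounded_op T -> T (f + g) = T f + T g.
Proof. by move=> /(bounded_opP 1 f g); rewrite !scale1r. Qed.

Lemma bounded_opZ T (a : R[i]) f : bounded_op T -> T (a *: f) = a *: T f.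
Proof.
by move=> bT; have := bounded_opP a f 0 bT; rewrite (bounded_op_0 bT) !addr0.
Qed.

Lemma bounded_opB T f g : bounded_op T -> T (f - g) = T f - T g.
Proof. by move=> bT; rewrite -[- g]scaleN1r -[- T g]scaleN1r (bounded_opD _ _ bT) (bounded_opZ _ _ bT). Qed.

Lemma bounded_op_sum T (I : Type) (r : seq I) (P : pred I) (u : I -> H) :
  bounded_op T -> T (\sum_(i <- r | P i) u i) = \sum_(i <- r | P i) T (u i).
Proof.
move=> bT; elim/big_rec2: _ => [|i a b _ <-]; first exact: bounded_op_0 bT.
exact: bounded_opD bT.
Qed.

Lemma bounded_op_lin (a : R[i]) S T :
  bounded_op S -> bounded_op T -> bounded_op (a *: S + T).
Proof.
move=> bS bT; have [_ [c c0 hc]] := bS; have [_ [e e0 he]] := bT; split.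
  move=> b f g; rewrite !opDE !opZE (bounded_opP _ _ _ bS) (bounded_opP _ _ _ bT).
  rewrite !scalerDr !scalerA mulrC -!addrA; congr (_ + _).
  by rewrite addrCA.
exists (2 * (`|a| ^+ 2 * c + e)).
  by rewrite mulr_ge0// addr_ge0// mulr_ge0// exprn_ge0.
move=> f; apply: le_trans (sqnormD _ _) _.
rewrite -mulrA ler_wpM2l// mulrDl lerD//.
by apply: le_trans (sqnormZ _ _) _; rewrite -[leRHS]mulrA ler_wpM2l// exprn_ge0.
Qed.

Lemma bounded_op_comp S T : bounded_op S -> bounded_op T -> bounded_op (S \o T).
Proof.
move=> bS bT; have [_ [c c0 hc]] := bS; have [_ [e e0 he]] := bT; split.
  by move=> a f g /=; rewrite (bounded_opP _ _ _ bT) (bounded_opP _ _ _ bS).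
exists (c * e); first exact: mulr_ge0.
by move=> f /=; apply: le_trans (hc _) _; rewrite -mulrA ler_wpM2l.
Qed.

Lemma bounded_op_cst0 : bounded_op (0 : B).
Proof.
split=> [a f g|]; first by rewrite !op0E scaler0 addr0.
by exists 0 => // f; rewrite mul0r; apply: sqnorm_le => F; rewrite big1// => i _; rewrite normr0 expr0n.
Qed.

Lemma bounded_op_subspace : linear_subspace (@bounded_op R X).
Proof. by split; [exact: bounded_op_cst0|exact: bounded_op_lin]. Qed.

Lemma bounded_op_unital_subalgebra : unital_subalgebra (@bounded_op R X).
Proof.
split=> //; [exact: bounded_op_subspace| |exact: bounded_op_comp].
by split=> //; exists 1 => // f; rewrite mul1r.
Qed.

Section subspace.
Variables (V : set B) (sV : linear_subspace V).

Lemma subspace0 : V 0. Proof. by case: sV. Qed.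
Lemma subspaceZ (a : R[i]) T : V T -> V (a *: T).
Proof.
case: sV => V0 VL VT; have := VL a T 0 VT V0; rewrite addr0; exact.
Qed.
Lemma subspaceD S T : V S -> V T -> V (S + T).
Proof. by case: sV => _ VL VS VT; have := VL 1 S T VS VT; rewrite scale1r. Qed.
Lemma subspaceB S T : V S -> V T -> V (S - T).
Proof. by move=> VS VT; rewrite -scaleN1r; apply: subspaceD => //; exact: subspaceZ. Qed.
Lemma subspace_sum (I : Type) (r : seq I) (P : pred I) (u : I -> B) :
  (forall i, P i -> V (u i)) -> V (\sum_(i <- r | P i) u i).
Proof. by move=> Vu; apply: big_ind => //; [exact: subspace0|exact: subspaceD]. Qed.
End subspace.

Lemma linear_span_subspace (D : set B) : linear_subspace (linear_span D).
Proof.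
split=> [V [V0 _] _ //|a S T hS hT V sV DV]; case: (sV) => _ VL.
by apply: VL; [exact: hS|exact: hT].
Qed.

Lemma sub_linear_span (D : set B) : D `<=` linear_span D.
Proof. by move=> T DT V _; apply. Qed.

(** A bounded operator is determined by its values on the basis: the
    truncations of [f] satisfy the claim term by term, and the error is
    controlled by the bound of [T].  Evaluating at a single coordinate [x] plays
    the part of an adjoint. *)
Lemma op_coord_eq0 T f x : bounded_op T ->
  (forall z, f z * T (basisv R z) x = 0) -> T f x = 0.
Proof.
move=> bT h; have [_ [c c0 hc]] := bT.
have key e : 0 < e -> `|T f x| ^+ 2 <= c * e.
  move=> /(trunc_approx f)[F hF].
  have -> : T f x = T (f - trunc F f) x.
    rewrite (bounded_opB _ _ bT) l2DE l2NE (bounded_op_sum _ _ _ bT) l2sumE big1 ?subr0// => z _.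
    by rewrite (bounded_opZ _ _ bT) l2ZE h.
  by apply: le_trans (coord_le _ _) _; apply: le_trans (hc _) _; rewrite ler_wpM2l.
apply/eqP; rewrite -normr_eq0 -sqrf_eq0; apply/negPn/negP => n0.
have p0 : 0 < `|T f x| ^+ 2 by rewrite lt_def n0 exprn_ge0.
have := key (`|T f x| ^+ 2 / (c + 1) / 2).
rewrite !divr_gt0// ?ltr_wpDl// => /(_ isT).
apply/negP; rewrite -real_ltNge ?ger0_real ?mulr_ge0 ?invr_ge0 ?addr_ge0 ?exprn_ge0//.
rewrite mulrA ltr_pdivrMr// mulrA ltr_pdivrMr ?ltr_wpDl//.
rewrite mulrC -mulrA ltr_pM2l//.
apply: (@lt_le_trans _ _ (c + 1)); first by rewrite ltrDl.
by rewrite ler_peMl ?addr_ge0// ler1n.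
Qed.

Lemma op_basis_ext S T : bounded_op S -> bounded_op T ->
  (forall z, S (basisv R z) = T (basisv R z)) -> S = T.
Proof.
move=> bS bT ST; apply/funext => f; apply: l2_ext => x; apply/eqP.
rewrite -subr_eq0 addrC -scaleN1r; apply/eqP.
apply: (op_coord_eq0 (bounded_op_lin (-1) bT bS)) => z.
by rewrite opDE opZE ST scaleN1r addNr l20E mulr0.
Qed.

Lemma continuous_wot_dotl2 f g :
  continuous (fun T : wot R X => dotl2 (T f) g : C).
Proof. exact: (@continuous_initial_ptws _ _ _ (@wot_eval R X) (f, g)). Qed.

(** The coordinates of [T f] are weakly continuous in [T]; all the weakly
    continuous functionals and maps below are finite combinations of these. *)
Lemma continuous_wot_coord f x : continuous (fun T : wot R X => T f x : C).
Proof.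
rewrite (_ : (fun _ => _) = (fun T : wot R X => dotl2 (T f) (basisv R x) : C)).
  exact: continuous_wot_dotl2.
by apply/funext => T; rewrite dotl2_basis.
Qed.

Lemma cvg_lincomb (W : Type) (F : set_system W) (FF : Filter F) (I : Type)
    (r : seq I) (phi : I -> W -> C) (l : I -> C) (a : I -> R[i]) :
  (forall i, phi i @ F --> l i) ->
  (\sum_(i <- r) phi i t * a i : C) @[t --> F] --> (\sum_(i <- r) l i * a i : C).
Proof.
move=> cphi; elim: r => [|i r IH].
  by under eq_fun do rewrite big_nil; rewrite big_nil; exact: cvg_cst.
under eq_fun do rewrite big_cons; rewrite big_cons.
by apply: cvgD; [apply: cvgMr_tmp; exact: cphi|exact: IH].
Qed.

Lemma continuous_lincomb (W : topologicalType) (I : Type) (r : seq I)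
    (phi : I -> W -> C) (a : I -> R[i]) :
  (forall i, continuous (phi i)) ->
  continuous (fun t : W => \sum_(i <- r) phi i t * a i : C).
Proof. by move=> cphi t; apply: cvg_lincomb => i; exact: cphi. Qed.

Lemma wot_closure_eq (S : set B) (phi psi : wot R X -> C) (T : B) :
  continuous phi -> continuous psi ->
  (forall T : B, S T -> phi T = psi T) -> wot_closure S T -> phi T = psi T.
Proof.
move=> cphi cpsi hS [_ clT]; apply/eqP; rewrite -subr_eq0; apply/eqP.
have ce : closed [set (0 : C)].
  by apply: accessible_closed_set1; apply: hausdorff_accessible; exact: norm_hausdorff.
suff : closure [set (0 : C)] (phi T - psi T) by move=> /ce.
apply: (@closure_image (wot R X) C (fun T => phi T - psi T) S _ T) => //.
  exact: cvgB (cphi T) (cpsi T).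
by move=> S' /hS ->; rewrite /= subrr.
Qed.

(** A weak operator functional is the weak* functional of a pair of sequences
    with a single nonzero term. *)
Lemma wstar_closure_sub_wot (S : set B) : wstar_closure S `<=` wot_closure S.
Proof.
move=> T [bT clT]; split=> //.
apply: (@closure_image (wstar R X) (wot R X) id S S T) => //.
apply: (@cvg_initial_ptws _ _ _ (@wot_eval R X) (nbhs (T : wstar R X))) => -[f g].
pose s h : nat -> H := fun n => if n == 0%N then h else 0.
have ss h : sqsummable_seq (s h).
  exists (sqnorm h) => -[|n]; first by rewrite big_ord0 sqnorm_ge0.
  rewrite big_ord_recl big1 ?addr0// => i _.
  by apply/eqP; rewrite eq_le sqnorm_ge0 andbT; apply: sqnorm_le => F; rewrite big1// => j _; rewrite normr0 expr0n.
pose p : wstar_index R X := exist _ (s f, s g) (conj (ss f) (ss g)).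
have E (S' : B) : wot_eval S' (f, g) = wstar_eval S' p.
  apply/esym; rewrite /wstar_eval/=.
  apply: norm_cvg_lim; apply: cvg_near_cst; exists [fset 0%N]%fset => // F /= /fsubsetP xF.
  rewrite partial_sumE (big_fsetD1 0%N)//= ?xF ?inE//= big1_fset; first exact: addr0.
  move=> n; rewrite in_fsetD1 /s => /andP[/negbTE -> _ _].
  by apply/eqP; rewrite -normr_le0; apply: dotl2_le => G; rewrite big1 ?normr0// => i _; rewrite l20E conjC0 mulr0.
under eq_fun do rewrite E; rewrite E.
exact: (@continuous_initial_ptws _ _ _ (@wstar_eval R X) p).
Qed.

Lemma wot_closure_mono (S S' : set B) : S `<=` S' -> wot_closure S `<=` wot_closure S'.
Proof. by move=> SS' T [bT cT]; split => //; apply: closure_subset cT. Qed.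

Lemma wstar_closure_mono (S S' : set B) : S `<=` S' -> wstar_closure S `<=` wstar_closure S'.
Proof. by move=> SS' T [bT cT]; split => //; apply: closure_subset cT. Qed.

End operators.

(** * Partial isometries given by injective partial maps *)
Section pullback.
Variables (R : realType) (X : choiceType) (p : X -> option X).
Hypothesis p_inj : forall x y z, p x = Some z -> p y = Some z -> x = y.
Local Notation C := (Cplx R).
Local Notation H := (l2 R X).

(** Left and right creation operators, their tensor products and the
    projections onto windows of degrees all have the form
    [f |-> f o p], extended by zero, with [p] injective where it is defined;
    hence they are contractions. *)
Lemma pullback_sum_le (f : H) (F : {fset X}) :
  \sum_(x <- F) `|oapp f 0 (p x) : R[i]| ^+ 2 <= sqnorm f.
Proof.
have up (s : seq X) : uniq s -> uniq (pmap p s).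
  elim: s => //= x s IH /andP[xs us]; case E: (p x) => [z|] /=; rewrite IH// andbT.
  rewrite mem_pmap; apply/mapP => -[y ys zE].
  by move: xs; rewrite (p_inj E (esym zE)) ys.
apply: le_trans (sqnorm_ge f [fset x in pmap p F]%fset).
have Es : perm_eq [fset x in pmap p F]%fset (pmap p F).
  by apply: uniq_perm => //= [|x]; [exact/up/fset_uniq|rewrite !inE].
rewrite (perm_big _ Es)/= big_pmap; apply: ler_sum => x _.
by case: (p x) => //=; rewrite normr0 expr0n.
Qed.

Lemma pullback_subproof (f : H) :
  (fun x => oapp f 0 (p x) : C) \in @square_summable R X.
Proof. by apply/asboolP; exists (sqnorm f) => F; exact: pullback_sum_le. Qed.

Definition pullback : op R X := fun f => L2 (pullback_subproof f).

Lemma pullbackE f x : pullback f x = oapp f 0 (p x). Proof. by []. Qed.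

Lemma bounded_pullback (T : op R X) :
  (forall f x, T f x = oapp f 0 (p x)) -> bounded_op T.
Proof.
move=> TE; split=> [a f g|].
  apply: l2_ext => x; rewrite TE l2DE l2ZE !TE.
  by case: (p x) => //=; rewrite mulr0 addr0.
exists 1 => // f; rewrite mul1r; apply: sqnorm_le => F.
by under eq_bigr do rewrite TE; exact: pullback_sum_le.
Qed.

End pullback.

(** * Fourier coefficients in the free semigroup algebra *)
Section free_semigroup_algebra_facts.
Variables (R : realType) (d : nat).
Local Notation C := (Cplx R).
Local Notation word := (word d).
Local Notation H := (l2 R word).
Local Notation BH := (op R word).
Local Notation L := (free_algebra R d).
Implicit Types (u v w x : word) (f g : H) (S T : BH).

Lemma creationE u f w :
  creation u f w = if prefix u w then f (drop (size u) w) else 0.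
Proof. by []. Qed.

Lemma bounded_creation u : bounded_op (creation (R := R) u).
Proof.
apply: (@bounded_pullback R word
  (fun w => if prefix u w then Some (drop (size u) w) else None)).
  move=> x y z; case: ifP => // /prefixP[x' ->]; case: ifP => // /prefixP[y' ->].
  by rewrite !drop_size_cat// => -[->] -[->].
by move=> f x; rewrite creationE; case: ifP.
Qed.

(** The partial inverse of [w |-> w ++ v]. *)
Definition rstrip v : word -> option word :=
  fun w => if suffix v w then Some (take (size w - size v) w) else None.

Lemma rstrip_cat v w : rstrip v (w ++ v) = Some w.
Proof. by rewrite /rstrip suffix_suffix size_cat addnK take_size_cat. Qed.

Lemma rstrip_some v x w : rstrip v x = Some w -> x = w ++ v.
Proof.
rewrite /rstrip; case: ifP => // /suffixP[y ->] [<-].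
by rewrite size_cat addnK take_size_cat.
Qed.

Lemma rstrip_inj v x y z : rstrip v x = Some z -> rstrip v y = Some z -> x = y.
Proof. by move=> /rstrip_some -> /rstrip_some ->. Qed.

(** The right creation operator, which sends the basis vector of [w] to that
    of [w ++ v]. *)
Definition rcreation v : BH := pullback (@rstrip_inj v).

Lemma bounded_rcreation v : bounded_op (rcreation v).
Proof. exact: (bounded_pullback (@rstrip_inj v)). Qed.

Lemma rcreation_basis v w : rcreation v (basisv R w) = basisv R (w ++ v : word).
Proof.
apply: l2_ext => x; rewrite pullbackE basisvE.
case E: (rstrip v x) => [y|] /=.
  rewrite (rstrip_some E); case: (eqVneq (size y) (size w)) => [yw|yw].
    by rewrite eqseq_cat// eqxx andbT.
  case: eqP => [yw'|_]; first by rewrite yw' eqxx in yw.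
  case: eqP => // /(congr1 size); rewrite !size_cat => /addIn yw'.
  by rewrite yw' eqxx in yw.
by case: eqP => // xE; move: E; rewrite xE rstrip_cat.
Qed.

Lemma creation_rcreation u v f :
  creation u (rcreation v f) = rcreation v (creation u f).
Proof.
have bc := bounded_op_comp (bounded_creation u) (bounded_rcreation v).
have br := bounded_op_comp (bounded_rcreation v) (bounded_creation u).
suff E : creation u \o rcreation v = rcreation v \o creation u by exact: (congr1 (@^~ f) E).
apply: op_basis_ext => // z /=.
by rewrite creation_basis !rcreation_basis creation_basis catA.
Qed.

Lemma wot_algebra_in (A : set BH) : unital_subalgebra A -> wot_closure A `<=` A ->
  (forall u, A (creation u)) -> L `<=` A.
Proof. by move=> uA cA crA T; apply => // _ [u _ <-]. Qed.

Lemma free_algebra_bounded T : L T -> bounded_op T.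
Proof.
apply: wot_algebra_in; [exact: bounded_op_unital_subalgebra|by move=> S []|].
exact: bounded_creation.
Qed.

Lemma free_algebra_subspace : linear_subspace L.
Proof.
split=> [A [_ [A0 _] _ _] _ _ //|a S T LS LT A uA cA crA].
by case: (uA) => _ [_ AL] _ _; apply: AL; [exact: LS|exact: LT].
Qed.

Lemma free_algebra_comp S T : L S -> L T -> L (S \o T).
Proof.
move=> LS LT A uA cA crA; case: (uA) => _ _ _ AM.
by apply: AM; [exact: LS|exact: LT].
Qed.

Lemma free_algebra_creation u : L (creation u).
Proof. by move=> A uA cA; apply; exists u. Qed.

Lemma free_algebra_wot_closed : wot_closure L `<=` L.
Proof.
move=> T LT A uA cA crA; apply: (cA); move: T LT.
by apply: wot_closure_mono => S; apply.
Qed.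

(** Left and right creation operators commute, and the commutant of the latter
    is a weakly closed unital algebra. *)
Lemma free_algebra_commutes_rcreation T v f : L T -> T (rcreation v f) = rcreation v (T f).
Proof.
move=> LT; pose A := [set T : BH | bounded_op T /\
  forall v f, T (rcreation v f) = rcreation v (T f)].
suff : A T by case.
apply: wot_algebra_in LT.
- split=> [S []//||//|].
  + split; first by split; [exact: bounded_op_cst0|move=> w g; rewrite (bounded_op_0 (bounded_rcreation w))].
    move=> a S S' [bS hS] [bS' hS']; split; first exact: bounded_op_lin.
    move=> w g; rewrite !opDE !opZE hS hS'.
    by rewrite (bounded_opP _ _ _ (bounded_rcreation w)).
  + by split=> //; case: (@bounded_op_unital_subalgebra R word).
  + move=> S S' [bS hS] [bS' hS']; split; first exact: bounded_op_comp.
    by move=> w g /=; rewrite hS' hS.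
- move=> S cS; split; first by case: cS.
  move=> w g; apply: l2_ext => x; rewrite pullbackE.
  have := wot_closure_eq (@continuous_wot_coord R word (rcreation w g) x) _ _ cS.
  case E: (rstrip w x) => [y|] /= h.
    apply: (h (fun T : wot R word => T g y : C)); first exact: continuous_wot_coord.
    by move=> S' [_ hS']; rewrite hS' pullbackE E.
  apply: (h (fun T : wot R word => 0 : C)); first exact: cst_continuous.
  by move=> S' [_ hS']; rewrite hS' pullbackE E.
- move=> u; split; first exact: bounded_creation.
  by move=> w g; exact: creation_rcreation.
Qed.

(** The Fourier coefficients: [T] is formally the series of the
    [fcoef T w *: creation w]. *)
Definition fcoef T w : R[i] := T (basisv R [::]) w.

Lemma fcoef_lin (a : R[i]) S T w : fcoef (a *: S + T) w = a * fcoef S w + fcoef T w.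
Proof. by []. Qed.

Lemma fcoef_sum (I : Type) (r : seq I) (P : pred I) (F : I -> BH) w :
  fcoef (\sum_(i <- r | P i) F i) w = \sum_(i <- r | P i) fcoef (F i) w.
Proof. by rewrite /fcoef opsumE l2sumE. Qed.

Lemma fcoef_creation u w : fcoef (creation u) w = (w == u)%:R.
Proof. by rewrite /fcoef creation_basis cats0. Qed.

Lemma free_algebra_basis T v x : L T -> T (basisv R v) x = oapp (fcoef T) 0 (rstrip v x).
Proof. by move=> LT; rewrite -[v in basisv R v]cat0s -rcreation_basis free_algebra_commutes_rcreation. Qed.

(** Since [T] commutes with right creation operators, its value on each basis
    vector is a translate of its value on that of the empty word.  Only the
    finitely many suffixes of [x] contribute to the coordinate [x], so the
    formal series acts on vectors by a finite convolution. *)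
Lemma free_algebra_convolution T f x : L T ->
  T f x = \sum_(i < (size x).+1) fcoef T (take i x) * f (drop i x).
Proof.
move=> LT; have bT := free_algebra_bounded LT.
pose s : H := \sum_(i < (size x).+1) f (drop i x) *: basisv R (drop i x).
have -> : T f x = T (f - s) x + T s x.
  by rewrite (bounded_opB _ _ bT) l2DE l2NE subrK.
have -> : T (f - s) x = 0; last first.
  rewrite add0r (bounded_op_sum _ _ _ bT) l2sumE; apply: eq_bigr => i _.
  have E : rstrip (drop i x) x = Some (take i x).
    by have := rstrip_cat (drop i x) (take i x); rewrite cat_take_drop.
  by rewrite (bounded_opZ _ _ bT) l2ZE free_algebra_basis// E mulrC.
apply: (op_coord_eq0 bT) => z.
rewrite free_algebra_basis//; case E: (rstrip z x) => [y|]; last by rewrite /= mulr0.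
rewrite [oapp _ _ _]/=; have xE := rstrip_some E.
have yx : (size y < (size x).+1)%N by rewrite xE size_cat ltnS leq_addr.
rewrite l2DE l2NE l2sumE (bigD1 (Ordinal yx))// l2ZE basisvE big1 => [|i iy].
  by rewrite /= xE drop_size_cat// eqxx mulr1 addr0 subrr mul0r.
rewrite l2ZE basisvE; case: eqP => [zE|]; last by rewrite mulr0.
move: iy; rewrite -val_eqE /= => /eqP[].
have zs : @size 'I_d z = (@size 'I_d x - i)%N by rewrite zE size_drop.
by have := ltn_ord i; have := congr1 (@size 'I_d) xE; rewrite size_cat; lia.
Qed.

Lemma free_algebra_ext S T : L S -> L T -> (forall w, fcoef S w = fcoef T w) -> S = T.
Proof.
move=> LS LT h; apply/funext => f; apply: l2_ext => x.
by rewrite !free_algebra_convolution//; apply: eq_bigr => i _; rewrite h.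
Qed.

Lemma fcoef_comp S T x : L S -> L T ->
  fcoef (S \o T) x = \sum_(i < (size x).+1) fcoef S (take i x) * fcoef T (drop i x).
Proof. by move=> LS LT; rewrite /fcoef /= free_algebra_convolution. Qed.

Definition component n T : BH :=
  \sum_(w : n.-tuple 'I_d) fcoef T w *: creation (tval w).

Lemma free_algebra_component n T : L (component n T).
Proof.
by apply: (subspace_sum free_algebra_subspace) => w _; apply: (subspaceZ free_algebra_subspace); exact: free_algebra_creation.
Qed.

Lemma fcoef_poly n (a : word -> R[i]) w :
  fcoef (\sum_(w : n.-tuple 'I_d) a w *: creation (tval w)) w =
    if size w == n then a w else 0.
Proof.
rewrite fcoef_sum; case: eqP => [wn|wn].
  subst n; rewrite (bigD1 (in_tuple w))//= big1 ?addr0.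
    by rewrite -[_ *: _]addr0 fcoef_lin fcoef_creation eqxx mulr1 addr0.
  move=> v vw; rewrite -[_ *: _]addr0 fcoef_lin fcoef_creation addr0.
  case: eqP => [wv|]; last by rewrite mulr0.
  by case/eqP: vw; exact/val_inj/esym.
rewrite big1// => v _; rewrite -[_ *: _]addr0 fcoef_lin fcoef_creation addr0.
by case: eqP => [wv|]; [case: wn; rewrite wv size_tuple|rewrite mulr0].
Qed.

Lemma fcoef_component n T w :
  fcoef (component n T) w = if size w == n then fcoef T w else 0.
Proof. exact: fcoef_poly. Qed.

(** Both sides belong to the algebra, so it suffices to compare Fourier
    coefficients; this avoids splitting tuples of length [n]. *)
Lemma component_comp n S T : L S -> L T ->
  component n (S \o T) = \sum_(i < n.+1) (component i S \o component (n - i) T : BH).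
Proof.
move=> LS LT; apply: free_algebra_ext => [||w]; first exact: free_algebra_component.
  by apply: (subspace_sum free_algebra_subspace) => i _; apply: free_algebra_comp; exact: free_algebra_component.
rewrite fcoef_component fcoef_sum.
under [RHS]eq_bigr => i _.
  rewrite fcoef_comp; [|exact: free_algebra_component..].
  under eq_bigr => j _ do rewrite !fcoef_component.
  over.
rewrite fcoef_comp// exchange_big/=.
case: eqP => [wn|wn].
  subst n; apply: eq_bigr => j _; have jw := ltn_ord j.
  have sj : size (take j w) = j by rewrite size_takel// -ltnS.
  rewrite (bigD1 (Ordinal jw))//= sj eqxx size_drop eqxx big1 ?addr0// => i ij.
  by case: eqP => [ji|]; [move: ij; rewrite -val_eqE /= ji eqxx|rewrite mul0r].
rewrite big1// => j _; rewrite big1// => i _; case: eqP => [ti|]; last by rewrite mul0r.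
case: eqP => [di|]; last by rewrite mulr0.
case: wn; rewrite -(cat_take_drop j w) size_cat ti di subnKC//.
by rewrite -ltnS.
Qed.

End free_semigroup_algebra_facts.

(** * Cauchy-Schwarz and counting for the windows *)
Section finite_sums.
Variable R : realType.
Implicit Types (u : nat -> R[i]).

Lemma sqr_norm_sum_le (I : finType) (b : I -> R[i]) :
  `|\sum_i b i| ^+ 2 <= #|I|%:R * \sum_i `|b i| ^+ 2.
Proof.
apply: (@le_trans _ _ ((\sum_i `|b i|) ^+ 2)).
  by rewrite lerXn2r ?nnegrE ?sumr_ge0// ler_norm_sum.
rewrite -(ler_pM2l (_ : 0 < 2 :> R[i]))//.
apply: (@le_trans _ _ (\sum_i \sum_j (`|b i| ^+ 2 + `|b j| ^+ 2))).
  rewrite expr2 mulr_suml mulr_sumr; apply: ler_sum => i _.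
  rewrite !mulr_sumr; apply: ler_sum => j _; rewrite -subr_ge0.
  rewrite (_ : _ - _ = (`|b i| - `|b j|) ^+ 2); last by ring.
  by apply: real_exprn_even_ge0 => //; apply: rpredB; exact: normr_real.
under eq_bigr do rewrite big_split sumr_const/=.
rewrite big_split/= sumr_const sumrMnl -mulr2n.
by rewrite [#|I|%:R * _]mulr_natl mulr_natl.
Qed.

(** The left-hand side is the part of the right-hand side over the indices
    from [a] to [a + N - 1]. *)
Lemma sum_shift_le u a N K : (forall k, 0 <= u k) -> (a + N <= K)%N ->
  \sum_(j < N) u (j + a)%N <= \sum_(k < K) u k.
Proof.
move=> u0 aNK; rewrite -(big_mkord xpredT u) -(big_mkord xpredT (fun j => u (j + a)%N)).
have aK : (a <= K)%N by exact: leq_trans (leq_addr _ _) aNK.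
rewrite [leRHS](@big_cat_nat _ _ _ a)//= addrC.
rewrite (@big_cat_nat _ _ _ (a + N) a)//= ?leq_addr//.
have -> : \sum_(a <= i < a + N) u i = \sum_(0 <= j < N) u (j + a)%N.
  by rewrite -{1}[a]add0n big_addn addKn.
by rewrite -addrA lerDl addr_ge0// sumr_ge0.
Qed.

Lemma count_shift_lt i M N :
  (\sum_(j < M) (j + i < N) = minn M (N - i))%N.
Proof. by elim: M => [|M IH]; rewrite ?big_ord0 ?big_ord_recr/= ?IH; lia. Qed.

Lemma count_window a N K : (\sum_(k < K) (a <= k < a + N) <= N)%N.
Proof.
suff -> : (\sum_(k < K) (a <= k < a + N) = minn K (a + N) - minn K a)%N by lia.
by elim: K => [|K IH]; rewrite ?big_ord0 ?big_ord_recr/= ?IH; lia.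
Qed.

End finite_sums.

(** * Fejer means *)
Section fejer.
Variables (R : realType) (d : nat).
Local Notation C := (Cplx R).
Local Notation word := (word d).
Local Notation H := (l2 R word).
Local Notation BH := (op R word).
Local Notation L := (free_algebra R d).
Implicit Types (x w : word) (f g : H) (T : BH).

(** The Cesaro mean of the partial sums of the Fourier series; the subtraction
    is truncated but [n < N]. *)
Definition fejer N T : BH :=
  \sum_(n < N) ((N - n)%:R / N%:R : R[i]) *: component n T.

Lemma free_algebra_fejer N T : L (fejer N T).
Proof.
apply: (subspace_sum (@free_algebra_subspace R d)) => n _.
by apply: (subspaceZ (@free_algebra_subspace R d)); exact: free_algebra_component.
Qed.

Lemma fcoef_fejer N T w :
  fcoef (fejer N T) w = (N - size w)%:R / N%:R * fcoef T w.
Proof.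
rewrite fcoef_sum.
under eq_bigr do rewrite -[_ *: _]addr0 fcoef_lin addr0 fcoef_component.
have [wN|Nw] := ltnP (size w) N.
  rewrite (bigD1 (Ordinal wN))//= eqxx big1 ?addr0// => n nw.
  by case: eqP => [wn|]; [move: nw; rewrite -val_eqE /= wn eqxx|rewrite mulr0].
rewrite big1 => [|n _]; last first.
  by case: eqP => [wn|]; [have := ltn_ord n; rewrite -wn ltnNge Nw|rewrite mulr0].
by move: Nw; rewrite -subn_eq0 => /eqP ->; rewrite !mul0r.
Qed.

(** The window of index [k] consists of the degrees from [k - N + 1] to [k].
    Each degree lies in exactly [N] windows; indexing by the upper end makes
    this true with [k] a natural number. *)
Definition in_window k N x := (size x <= k < size x + N)%N.

Definition restrict_window k N x := if in_window k N x then Some x else None.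

Lemma restrict_window_inj k N x y z :
  restrict_window k N x = Some z -> restrict_window k N y = Some z -> x = y.
Proof.
by rewrite /restrict_window; case: ifP => // _ [->]; case: ifP => // _ [->].
Qed.

Definition window k N : BH := pullback (@restrict_window_inj k N).

Lemma windowE k N f x : window k N f x = if in_window k N x then f x else 0.
Proof. by rewrite pullbackE /restrict_window; case: ifP. Qed.

(** The Fejer kernel is an average of compressions: a word [y] of length [i]
    moves degree [m] to [m + i], and exactly [N - i] windows contain both. *)
Lemma fejer_window N T f x : L T ->
  fejer N T f x = N%:R^-1 * \sum_(j < N) T (window (j + size x) N f) x.
Proof.
move=> LT; rewrite free_algebra_convolution; last exact: free_algebra_fejer.
under [in RHS]eq_bigr do rewrite free_algebra_convolution//.
rewrite exchange_big/= mulr_sumr; apply: eq_bigr => i _.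
have ix : (i <= size x)%N by rewrite -ltnS.
rewrite fcoef_fejer size_takel// -mulr_sumr.
have -> : \sum_(j < N) window (j + size x) N f (drop i x) =
    (N - i)%:R * f (drop i x).
  rewrite -[(N - i)%N](_ : minn N (N - i) = _); last by lia.
  rewrite -count_shift_lt natr_sum mulr_suml; apply: eq_bigr => j _.
  rewrite windowE /in_window size_drop.
  have -> : (size x - i <= j + size x < size x - i + N)%N = (j + i < N)%N by lia.
  by case: (_ < _)%N; rewrite ?mul1r ?mul0r.
ring.
Qed.

Lemma sum_window_le N K f :
  \sum_(k < K) sqnorm (window k N f) <= N%:R * sqnorm f.
Proof.
apply: sum_sqnorm_le => F; rewrite exchange_big.
apply: le_trans (ler_wpM2l (ler0n _ N) (sqnorm_ge f F)).
rewrite mulr_sumr; apply: ler_sum => x _.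
rewrite (eq_bigr (fun k : 'I_K => (in_window k N x)%:R * `|f x| ^+ 2)); last first.
  by move=> k _; rewrite windowE; case: ifP; rewrite ?mul1r// normr0 expr0n mul0r.
rewrite -mulr_suml -natr_sum ler_wpM2r ?exprn_ge0// ler_nat.
exact: count_window.
Qed.

(** The Fejer means are bounded by the same constant as [T].  By Cauchy-Schwarz
    for the average over [N] windows, the squared norm of the mean is at most
    the average of the squared norms of [T (window k N f)], and the squared
    norms of the [window k N f] add up to at most [N * sqnorm f]. *)
Lemma fejer_bound N T (c : R[i]) f : L T -> 0 <= c ->
  (forall g, sqnorm (T g) <= c * sqnorm g) ->
  sqnorm (fejer N T f) <= c * sqnorm f.
Proof.
case: N => [|N] LT c0 hc.
  rewrite /fejer big_ord0 op0E; apply: (@le_trans _ _ 0).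
    by apply: sqnorm_le => F; rewrite big1// => i _; rewrite normr0 expr0n.
  by rewrite mulr_ge0// sqnorm_ge0.
apply: sqnorm_le => F; pose K := (\max_(x <- F) size x + N.+1)%N.
have N0 : 0 < N.+1%:R :> R[i] by rewrite ltr0n.
apply: (@le_trans _ _ (N.+1%:R^-1 * \sum_(k < K) \sum_(x <- F)
    `|T (window k N.+1 f) x| ^+ 2)).
  rewrite exchange_big/= mulr_sumr big_seq [leRHS]big_seq; apply: ler_sum => x xF.
  rewrite fejer_window// normrM exprMn ger0_norm ?invr_ge0//.
  apply: le_trans (ler_wpM2l _ (sqr_norm_sum_le _)) _; first by rewrite exprn_ge0// invr_ge0.
  rewrite card_ord expr2 -mulrA mulKf ?gt_eqF// ler_wpM2l ?invr_ge0//.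
  apply: (sum_shift_le (u := fun k => `|T (window k N.+1 f) x| ^+ 2)).
    by move=> k; exact: exprn_ge0.
  by rewrite leq_add2r; apply: (@leq_bigmax_seq _ _ xpredT (fun x : word => size x)).
rewrite ler_pdivrMl//; apply: (@le_trans _ _ (\sum_(k < K) c * sqnorm (window k N.+1 f))).
  by apply: ler_sum => k _; apply: le_trans (hc _); exact: sqnorm_ge.
by rewrite -mulr_sumr mulrCA ler_wpM2l// sum_window_le.
Qed.

End fejer.

(** * Weak* convergence of the Fejer means *)
Section weak_star_convergence.
Variables (R : realType).
Local Notation C := (Cplx R).

Lemma sum_fset_of_uniq (Y : choiceType) (s : seq Y) (h : Y -> R[i]) :
  uniq s -> \sum_(y <- s) h y = \sum_(y <- [fset y in s]%fset) h y.
Proof.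
move=> us; apply: perm_big; by apply: uniq_perm => //= y; rewrite !inE.
Qed.

Lemma fset_sum_le_uniq (Y : choiceType) (F : {fset Y}) (s : seq Y) (h : Y -> R[i]) :
  (forall y, 0 <= h y) -> uniq s -> {subset F <= s} ->
  \sum_(y <- F) h y <= \sum_(y <- s) h y.
Proof.
move=> h0 us Fs; rewrite (sum_fset_of_uniq h us); apply: fset_sum_le => //.
by apply/fsubsetP => y yF; rewrite !inE Fs.
Qed.

(** The weight [t] balances a fixed bound on the [a] side against an
    arbitrarily small one on the [b] side. *)
Lemma weighted_amgm (t a b : R[i]) : 0 < t ->
  `|a| * `|b| <= t * `|a| ^+ 2 + t^-1 * `|b| ^+ 2.
Proof.
move=> t0; have := normM_le_sqrD (t * a) b.
rewrite normrM (gtr0_norm t0) exprMn -(ler_pM2l (_ : 0 < t^-1)) ?invr_gt0//.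
have tn0 : t != 0 by rewrite gt_eqF.
have E1 : t^-1 * (t * `|a| * `|b|) = `|a| * `|b| by rewrite -mulrA mulKf.
have E2 : t^-1 * (t ^+ 2 * `|a| ^+ 2) = t * `|a| ^+ 2 by rewrite [t ^+ 2]expr2 -mulrA mulKf.
by rewrite mulrDr E1 E2.
Qed.

Lemma ratio_cvg (i : nat) :
  ((N - i)%:R / N%:R : C) @[N --> \oo] --> (1 : C).
Proof.
apply/cvgrPdist_le => e e0.
have eE : e = (complex.Re e)%:C%C by rewrite RRe_real ?gtr0_real.
have r0 : 0 < complex.Re e by rewrite -ltcR -eE.
pose K := Num.bound (i%:R / complex.Re e).
have hK : i%:R / complex.Re e < K%:R by apply: archi_boundP; rewrite divr_ge0// ltW.
exists (K + i).+1 => // N /= KN.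
have N0 : 0 < N%:R :> R[i] by rewrite ltr0n; lia.
rewrite natrB; last by lia.
rewrite mulrBl divff ?gt_eqF// opprB addrC subrK ger0_norm ?divr_ge0//.
rewrite ler_pdivrMr// eE -(rmorph_nat (real_complex R)) -[N%:R](rmorph_nat (real_complex R)).
rewrite -rmorphM lecR mulrC -ler_pdivrMr//; apply: le_trans (ltW hK) _.
by rewrite ler_nat; lia.
Qed.

Section pairing.
Variable X : choiceType.
Local Notation H := (l2 R X).
Local Notation B := (op R X).
Implicit Types (f g : nat -> H) (S T : B).

Lemma dotl2_norm_le (a b : H) : `|dotl2 a b| <= sqnorm a + sqnorm b.
Proof.
apply: dotl2_le => F; apply: le_trans (lerD (sqnorm_ge a F) (sqnorm_ge b F)).
rewrite -big_split/=; apply: le_trans (ler_norm_sum _ _ _) _; apply: ler_sum => i _.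
by rewrite normrM norm_conjC normM_le_sqrD.
Qed.

Lemma sqsummable_fset f : sqsummable_seq f ->
  exists2 M : R[i], 0 <= M & forall F : {fset nat}, \sum_(n <- F) sqnorm (f n) <= M.
Proof.
move=> [M hM]; have M0 : 0 <= M by have := hM 0%N; rewrite big_ord0.
exists M => // F; apply: le_trans (hM (\max_(n <- F) n).+1).
rewrite -(big_mkord xpredT (fun n => sqnorm (f n))).
apply: fset_sum_le_uniq => [n||n nF]; [exact: sqnorm_ge0|exact: iota_uniq|].
rewrite mem_index_iota/= ltnS; exact: (@leq_bigmax_seq _ _ xpredT id).
Qed.

Lemma pairing_summable S f g : bounded_op S ->
  sqsummable_seq f -> sqsummable_seq g ->
  abs_summable (fun n => dotl2 (S (f n)) (g n)).
Proof.
move=> [_ [c c0 hc]] /sqsummable_fset[M _ hM] /sqsummable_fset[N _ hN].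
exists (c * M + N) => F.
apply: (@le_trans _ _ (\sum_(n <- F) (c * sqnorm (f n) + sqnorm (g n)))).
  apply: ler_sum => n _; apply: le_trans (dotl2_norm_le _ _) _.
  by rewrite lerD2r.
by rewrite big_split/= lerD// -mulr_sumr ler_wpM2l.
Qed.

(** A square summable sequence of vectors is square summable as a family
    indexed by pairs, so up to [e] it is carried by a finite set of pairs. *)
Lemma pairing_tail g : sqsummable_seq g -> forall e : R[i], 0 < e ->
  exists G : {fset nat * X}, forall F : {fset nat * X},
    \sum_(p <- F | p \notin G) `|g p.1 p.2| ^+ 2 <= e.
Proof.
move=> /sqsummable_fset[M _ hM] e e0.
pose h (p : nat * X) : R[i] := `|g p.1 p.2| ^+ 2.
have h0 p : 0 <= h p by exact: exprn_ge0.
apply: (nneg_tail (M := M) h0) => // F; pose F1 := [fset p.1 | p in F]%fset; pose F2 := [fset p.2 | p in F]%fset.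
apply: le_trans (hM F1).
apply: (@le_trans _ _ (\sum_(n <- F1) \sum_(x <- F2) `|g n x| ^+ 2)); last first.
  by apply: ler_sum => n _; exact: sqnorm_ge.
pose s := [seq (n, x) | n <- F1, x <- F2].
have us : uniq s by rewrite allpairs_uniq ?fset_uniq// => -[? ?] [? ?].
rewrite -(big_allpairs (F := h)).
apply: (fset_sum_le_uniq h0 us).
move=> [n x] pF; apply/allpairsP; exists (n, x); split=> //=.
  by apply/imfsetP; exists (n, x).
by apply/imfsetP; exists (n, x).
Qed.

(** On the finite set [G] the terms of the double sum are kept; outside of it
    they are small because [g] is, whatever [S] of the given norm. *)
Lemma pairing_bound S (c M t e : R[i]) f g (G : {fset nat * X}) (I : {fset nat}) :
  0 <= c -> (forall h, sqnorm (S h) <= c * sqnorm h) ->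
  (forall F : {fset nat}, \sum_(n <- F) sqnorm (f n) <= M) ->
  0 < t ->
  (forall F : {fset nat * X}, \sum_(p <- F | p \notin G) `|g p.1 p.2| ^+ 2 <= t * e) ->
  `|\sum_(n <- I) dotl2 (S (f n)) (g n)| <=
    \sum_(p <- G) `|S (f p.1) p.2| * `|g p.1 p.2| + (t * (c * M) + e).
Proof.
move=> c0 hc hM t0 hG.
have [su <-] := csum_sum I (fun n => dotl2_summable (S (f n)) (g n)).
apply: csum_le su _ => F; rewrite exchange_big/=.
apply: (@le_trans _ _ (\sum_(n <- I) \sum_(x <- F) `|S (f n) x| * `|g n x|)).
  apply: le_trans (ler_norm_sum _ _ _) _; apply: ler_sum => n _.
  apply: le_trans (ler_norm_sum _ _ _) _; apply: ler_sum => x _.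
  by rewrite normrM norm_conjC.
pose s := [seq (n, x) | n <- I, x <- F].
have us : uniq s by rewrite allpairs_uniq ?fset_uniq// => -[? ?] [? ?].
rewrite -(big_allpairs (F := fun p => `|S (f p.1) p.2| * `|g p.1 p.2|)) (sum_fset_of_uniq _ us).
rewrite (bigID (mem G))/= lerD//.
  rewrite big_fset_condE/=; apply: fset_sum_le => [p|]; first by rewrite mulr_ge0.
  by apply/fsubsetP => p; rewrite !inE => /andP[].
apply: (@le_trans _ _ (\sum_(p <- [fset p in s]%fset | p \notin G)
   (t * `|S (f p.1) p.2| ^+ 2 + t^-1 * `|g p.1 p.2| ^+ 2))).
  by apply: ler_sum => p _; exact: weighted_amgm.
rewrite big_split/= lerD//; last first.
  by rewrite -mulr_sumr ler_pdivrMl.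
rewrite -mulr_sumr; apply: ler_wpM2l; first exact: ltW.
apply: (@le_trans _ _ (\sum_(p <- [fset p in s]%fset) `|S (f p.1) p.2| ^+ 2)).
  by rewrite big_fset_condE/=; apply: fset_sum_le => [p|];
    [exact: exprn_ge0|apply/fsubsetP => p; rewrite !inE => /andP[]].
rewrite -(sum_fset_of_uniq _ us).
rewrite big_allpairs.
apply: (@le_trans _ _ (\sum_(n <- I) c * sqnorm (f n))).
  by apply: ler_sum => n _; apply: le_trans (hc _); exact: (sqnorm_ge (S (f n)) F).
by rewrite -mulr_sumr ler_wpM2l.
Qed.

(** The bound on the norms makes the tails of the weak* functional uniformly
    small, and finitely many coordinates remain. *)
Lemma bounded_cvg_wstar T (u : nat -> B) (c : R[i]) :
  bounded_op T -> (forall N, bounded_op (u N)) -> 0 <= c ->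
  (forall N h, sqnorm (u N h) <= c * sqnorm h) ->
  (forall h x, (u N h x : C) @[N --> \oo] --> (T h x : C)) ->
  forall p : wstar_index R X,
    wstar_eval (u N) p @[N --> \oo] --> wstar_eval T p.
Proof.
move=> bT bu c0 hc ux p; have [_ [c' c'0 hc']] := bT.
case: p => -[f g] [/= sf sg]; rewrite /wstar_eval/=.
have [M M0 hM] := sqsummable_fset sf.
pose b := 2 * (c + c'); have b0 : 0 <= b by rewrite mulr_ge0// addr_ge0.
pose D N : B := -1 *: T + u N.
have DE N h x : D N h x = u N h x - T h x.
  by rewrite [LHS](_ : _ = (-1 : R[i]) * T h x + u N h x)// mulN1r addrC.
have bD N : bounded_op (D N) by exact: bounded_op_lin.
have hD N h : sqnorm (D N h) <= b * sqnorm h.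
  apply: le_trans (sqnormD _ _) _; rewrite -mulrA ler_wpM2l// addrC mulrDl lerD//.
  by apply: le_trans (sqnormZ _ _) _; rewrite normrN1 expr1n mul1r.
have ED N : csum (fun n => dotl2 (u N (f n)) (g n) : C) - csum (fun n => dotl2 (T (f n)) (g n) : C) =
    csum (fun n => dotl2 (D N (f n)) (g n) : C).
  have -> : (fun n => dotl2 (D N (f n)) (g n) : C) =
      (fun n => -1 * dotl2 (T (f n)) (g n) + dotl2 (u N (f n)) (g n) : C).
    by apply/funext => n; rewrite -dotl2Dl.
  by rewrite csumD ?mulN1r 1?addrC//; exact: pairing_summable.
apply/cvgrPdist_le => e e0.
have e3 : 0 < e / 3 by rewrite divr_gt0.
have bM : 0 < b * M + 1 by rewrite ltr_wpDl// mulr_ge0.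
pose t := e / 3 / (b * M + 1); have t0 : 0 < t by rewrite divr_gt0.
have [G hG] := pairing_tail sg (mulr_gt0 t0 e3).
have cG : (\sum_(p <- G) (`|D N (f p.1) p.2| : C) * `|g p.1 p.2| : C) @[N --> \oo]
    --> (\sum_(p <- G) (0 : C) * `|g p.1 p.2| : C).
  apply: cvg_lincomb => -[n x] /=; apply/cvgrPdist_le => e' e'0.
  have /cvgrPdist_le/(_ e' e'0) := ux (f n) x; apply: filterS => N.
  by apply: le_trans; rewrite sub0r normrN normr_id [leRHS]distrC -DE.
move/cvgrPdist_le : cG => /(_ _ e3); apply: filterS => N.
rewrite [X in X - _]big1 => [|p _]; last by rewrite mul0r.
rewrite sub0r normrN => hN; rewrite distrC ED.
apply: csum_le (pairing_summable (bD N) sf sg) _ => I.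
apply: le_trans (pairing_bound I b0 (hD N) hM t0 hG) _.
rewrite [leRHS](_ : e = e / 3 + (e / 3 + e / 3)); last by field.
apply: lerD; first by apply: le_trans hN; apply: real_ler_norm; apply: ger0_real; apply: sumr_ge0 => p _; rewrite mulr_ge0.
rewrite lerD2r /t mulrAC ler_pdivrMr//.
by apply: ler_wpM2l; [exact: ltW|rewrite lerDl].
Qed.

End pairing.

Lemma fejer_coord_cvg d (T : op R (word d)) f x : free_algebra R d T ->
  (fejer N T f x : C) @[N --> \oo] --> (T f x : C).
Proof.
move=> LT; rewrite (free_algebra_convolution f x LT).
under eq_fun do rewrite (free_algebra_convolution f x (free_algebra_fejer _ _)).
rewrite (eq_bigr (fun i : 'I_(size x).+1 => (1 : C) * (fcoef T (take i x) * f (drop i x)))); last first.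
  by move=> i _; rewrite mul1r.
rewrite (_ : (fun N => _) = (fun N => \sum_(i < (size x).+1)
   ((N - i)%:R / N%:R : C) * (fcoef T (take i x) * f (drop i x)))).
  by apply: cvg_lincomb => i; exact: ratio_cvg.
apply/funext => N; apply: eq_bigr => i _.
by rewrite fcoef_fejer size_takel ?mulrA// -ltnS.
Qed.

(** The Fejer means are combinations of the homogeneous components of [T].
    Hence a weak* closed subspace contains [T] once it contains these
    components. *)
Lemma free_algebra_wstar_span_component d (T : op R (word d)) (V : set (op R (word d))) :
  free_algebra R d T -> linear_subspace V -> (forall n, V (component n T)) ->
  wstar_closure V T.
Proof.
move=> LT sV VT; have bT := free_algebra_bounded LT; split=> //.
apply: (@closure_initial_cvg _ _ _ (@wstar_eval R (word d)) V (fun N => fejer N T)).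
  by move=> N; apply: (subspace_sum sV) => n _; apply: (subspaceZ sV).
move=> p; have [_ [c c0 hc]] := bT.
have bF N : bounded_op (fejer N T) by exact: (free_algebra_bounded (free_algebra_fejer N T)).
have hF N h : sqnorm (fejer N T h) <= c * sqnorm h by exact: fejer_bound.
have cF h x : (fejer N T h x : C) @[N --> \oo] --> (T h x : C) by exact: fejer_coord_cvg.
exact: (bounded_cvg_wstar bT bF c0 hF cF).
Qed.

End weak_star_convergence.

(** * Congruences and the ideals they span *)
Section congruences.
Variables (R : realType) (d : nat).
Local Notation C := (Cplx R).
Local Notation word := (word d).
Local Notation word0 := (word0 d).
Local Notation BH := (op R word).
Local Notation L := (free_algebra R d).
Implicit Types (u v w x : word) (a b : word0) (S T : BH).

Lemma creation_comp u v : creation u \o creation v = creation (u ++ v) :> BH.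
Proof.
apply: op_basis_ext => [||z]; first exact: bounded_op_comp (bounded_creation R u) (bounded_creation R v).
  exact: bounded_creation.
by rewrite /= !creation_basis catA.
Qed.

Lemma free_algebra_creation0 a : L (creation0 a).
Proof. by case: a => [u|]; [exact: free_algebra_creation|exact: (subspace0 (@free_algebra_subspace R d))]. Qed.

Lemma creation0_mul a b : creation0 (mulw0 a b) = creation0 a \o creation0 b :> BH.
Proof.
case: a b => [u|] [v|] //=; first by rewrite creation_comp.
by apply/funext => f /=; rewrite (bounded_op_0 (bounded_creation R u)).
Qed.

Lemma fcoef_creation0 a w : fcoef (creation0 a) w = (a == Some w)%:R :> R[i].
Proof.
case: a => [u|] //=; rewrite fcoef_creation eq_sym; congr (_%:R).
Qed.

Lemma component_lin n (c : R[i]) S T :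
  component n (c *: S + T) = c *: component n S + component n T.
Proof.
rewrite /component scaler_sumr -big_split/=; apply: eq_bigr => w _.
by rewrite fcoef_lin scalerDl scalerA.
Qed.

Lemma component0 n : component n 0 = 0 :> BH.
Proof. by rewrite /component big1// => w _; rewrite scale0r. Qed.

Lemma component_component m n T :
  component m (component n T) = if m == n then component n T else 0.
Proof.
rewrite /component; case: eqP => [->|mn].
  by apply: eq_bigr => w _; rewrite fcoef_component size_tuple eqxx.
by rewrite big1// => w _; rewrite fcoef_component size_tuple; case: eqP => // _; rewrite scale0r.
Qed.

Lemma homogeneous_component n T : homogeneous_poly (component n T).
Proof. by exists n, (fun w => fcoef T w). Qed.

(** A polynomial homogeneous of degree [m] is its own component of degree
    [m], so taking components twice decides between the two cases. *)
Lemma component_homogeneous_poly n T : homogeneous_poly T ->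
  component n T = T \/ component n T = 0.
Proof.
move=> [m [c ->]].
have E : \sum_(w : m.-tuple 'I_d) c w *: creation w =
    component m (\sum_(w : m.-tuple 'I_d) c w *: creation w) :> BH.
  apply: eq_bigr => w _; congr (_ *: _).
  rewrite fcoef_sum (bigD1 w)//= big1 => [|v vw].
    by rewrite -[_ *: _]addr0 fcoef_lin fcoef_creation eqxx mulr1 !addr0.
  rewrite -[_ *: _]addr0 fcoef_lin fcoef_creation.
  by case: eqP => [wv|]; [case/eqP: vw; exact/val_inj/esym|rewrite mulr0 addr0].
by rewrite E component_component; case: eqP => _; [left|right].
Qed.

(** Weakly closed ideals are weak* closed, so the Fejer means apply. *)
Lemma ideal_of_components (J : set BH) T : ideal J -> L T ->
  (forall n, J (component n T)) -> J T.
Proof.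
move=> [_ sJ _ cJ] LT JT; apply: cJ; apply: wstar_closure_sub_wot.
exact: free_algebra_wstar_span_component.
Qed.

Section span.
Variable sim : word0 -> word0 -> Prop.
Hypothesis sim_cong : homogeneous_congruence sim.

Definition differences : set BH :=
  [set creation0 p.1 - creation0 p.2 | p in [set p | sim p.1 p.2]].
Local Notation D := differences.

Let sim_refl a : sim a a. Proof. by case: sim_cong => -[[]]. Qed.
Let sim_sym a b : sim a b -> sim b a. Proof. by case: sim_cong => -[[]] _ + _ _ _; exact. Qed.
Let sim_trans a b c : sim a b -> sim b c -> sim a c.
Proof. by case: sim_cong => -[[]] _ _ + _ _; exact. Qed.
Let sim_mul a a' b b' : sim a a' -> sim b b' -> sim (mulw0 a b) (mulw0 a' b').
Proof. by case: sim_cong => -[] _ + _; exact. Qed.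
Let sim_size u v : sim (Some u) (Some v) -> ~ sim (Some u) None -> size u = size v.
Proof. by case: sim_cong => _ h uv u0; apply: h => //; left. Qed.

(** The functionals that cut out the span of the differences in degree [n]:
    one for each class of words that is not the class of zero. *)
Definition class_sum n u T : R[i] :=
  \sum_(w : n.-tuple 'I_d) fcoef T w * `[< sim (Some u) (Some (tval w)) >]%:R.

(** Homogeneity of the congruence enters here: the class of [u] consists of
    words of length [n], so no coefficient of it is missed by the sum. *)
Lemma class_sum_creation0 n u a : size u = n -> ~ sim (Some u) None ->
  class_sum n u (creation0 a) = `[< sim (Some u) a >]%:R.
Proof.
move=> un u0; rewrite /class_sum; under eq_bigr do rewrite fcoef_creation0.
case: asboolP => ua; last first.
  rewrite big1// => w _; case: eqP => [aw|_]; last by rewrite mul0r.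
  by rewrite -aw asboolF// mulr0.
case: a ua => [x|] // ux; have xn : size x = n by rewrite -un; exact/esym/sim_size.
subst n; rewrite -xn.
rewrite (bigD1 (in_tuple x))//= eqxx mul1r asboolT// big1 ?addr0// => w wx.
case: eqP => [[xw]|]; last by rewrite mul0r.
by case/eqP: wx; exact/val_inj/esym.
Qed.

Lemma class_sum_span n u S : size u = n -> ~ sim (Some u) None ->
  linear_span D S -> class_sum n u S = 0.
Proof.
move=> un u0 /(_ [set S | class_sum n u S = 0]); apply.
  split=> [|c S1 S2 /= h1 h2]; rewrite /class_sum/=.
    by rewrite big1// => w _; rewrite mul0r.
  under eq_bigr do rewrite fcoef_lin mulrDl -mulrA.
  by rewrite big_split/= -mulr_sumr; rewrite /class_sum in h1 h2; rewrite h1 h2 mulr0 addr0.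
move=> _ [[a b] /= ab <-]; rewrite /class_sum.
under eq_bigr do rewrite -scaleN1r addrC fcoef_lin mulrDl -mulrA.
rewrite big_split/= -mulr_sumr -!/(class_sum _ _ _) !class_sum_creation0//.
rewrite mulN1r addrC; apply/eqP; rewrite subr_eq0; apply/eqP; congr (nat_of_bool _)%:R.
by apply/asbool_equiv_eq; split=> h; [exact: sim_trans ab|exact: sim_trans (sim_sym ab)].
Qed.

(** A representative in [n.-tuple 'I_d] of each class, [None] for the class of
    zero.  The boolean predicates of two equivalent words agree, so [pick]
    returns the same representative for both. *)
Definition class_rep n (w : n.-tuple 'I_d) : option (n.-tuple 'I_d) :=
  if `[< sim (Some (tval w)) None >] then None
  else [pick x : n.-tuple 'I_d | `[< sim (Some (tval w)) (Some (tval x)) >]].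

Lemma class_repP n (w : n.-tuple 'I_d) :
  sim (Some (tval w)) (omap (@tval _ _) (class_rep w)).
Proof.
rewrite /class_rep; case: asboolP => // w0; case: pickP => /= [x /asboolP//|].
by move=> /(_ w); rewrite asboolT.
Qed.

Lemma class_rep_eq n (w0 w : n.-tuple 'I_d) : ~ sim (Some (tval w0)) None ->
  (class_rep w == class_rep w0) = `[< sim (Some (tval w0)) (Some (tval w)) >].
Proof.
move=> w00; apply/eqP/asboolP => [E|h].
  by apply: sim_trans (class_repP w0) _; rewrite -E; apply: sim_sym; exact: class_repP.
rewrite /class_rep !asboolF//; last by move=> h'; apply: w00; exact: sim_trans h'.
apply: eq_pick => x /=; apply/asbool_equiv_eq; split=> h'.
  exact: sim_trans h'.
exact: sim_trans (sim_sym h) h'.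
Qed.

(** Subtracting from each [creation w] the creation operator of its
    representative leaves one term for each class, whose coefficient is the
    class sum. *)
Lemma span_of_class_sums n T :
  (forall u : n.-tuple 'I_d, ~ sim (Some (tval u)) None -> class_sum n u T = 0) ->
  linear_span D (component n T).
Proof.
move=> hT; pose r (w : n.-tuple 'I_d) : BH := creation0 (omap (@tval _ _) (class_rep w)).
have -> : component n T =
    \sum_(w : n.-tuple 'I_d) fcoef T w *: (creation (tval w) - r w).
  under eq_bigr do rewrite scalerBr.
  rewrite big_split/= sumrN; apply/esym/eqP; rewrite subr_eq addrC -subr_eq subrr; apply/eqP.
  rewrite (partition_big (@class_rep n) xpredT)//= big1// => o _.
  rewrite (eq_bigr (fun w : n.-tuple 'I_d => fcoef T w *: (creation0 (omap (@tval _ _) o) : BH))); last first.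
    by move=> w /eqP <-.
  rewrite -scaler_suml; case: o => [x|]; last by rewrite scaler0.
  have [[w0 /eqP w0x]|nx] := pselect (exists w0 : n.-tuple 'I_d, class_rep w0 == Some x); last first.
    rewrite big_pred0 ?scale0r// => w; apply/negP => wx; apply: nx; by exists w.
  have w00 : ~ sim (Some (tval w0)) None.
    by move=> h; move: w0x; rewrite /class_rep asboolT.
  rewrite -w0x (eq_bigl (fun w : n.-tuple 'I_d => `[< sim (Some (tval w0)) (Some (tval w)) >])); last first.
    by move=> w; rewrite class_rep_eq.
  rewrite (_ : \sum_(w | _) _ = 0) ?scale0r// -[RHS](hT w0 w00).
  rewrite [LHS]big_mkcond /class_sum; apply: eq_bigr => w _.
  by case: asbool; rewrite ?mulr1 ?mulr0.
apply: (subspace_sum (@linear_span_subspace _ _ D)) => w _.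
apply: (subspaceZ (@linear_span_subspace _ _ D)); apply: sub_linear_span.
by exists (Some (tval w), omap (@tval _ _) (class_rep w)) => //=; exact: class_repP.
Qed.

(** An algebraic description of the weak* closed span of the differences, which
    makes its weak closedness and its closure under products checkable degree by
    degree. *)
Definition graded_span : set BH :=
  [set T | L T /\ forall n, linear_span D (component n T)].
Local Notation K := graded_span.

Lemma span_L : linear_span D `<=` L.
Proof.
move=> T; apply; first exact: free_algebra_subspace.
by move=> _ [[a b] _ <-]; apply: (subspaceB (@free_algebra_subspace R d)); exact: free_algebra_creation0.
Qed.

Lemma continuous_class_sum n u :
  continuous (class_sum n u : wot R word -> C).
Proof. by apply: continuous_lincomb => w; exact: continuous_wot_coord. Qed.

Lemma graded_span_subspace : linear_subspace K.
Proof.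
split=> [|c S T [LS hS] [LT hT]].
  split; first exact: (subspace0 (@free_algebra_subspace R d)).
  by move=> n; rewrite component0; exact: subspace0 (@linear_span_subspace _ _ D).
split; first by case: (@free_algebra_subspace R d) => _; exact.
by move=> n; rewrite component_lin; case: (@linear_span_subspace _ _ D) => _; exact.
Qed.

(** Class sums are weakly continuous, so they still vanish on weak limits. *)
Lemma graded_span_of_wot_closure (V : set BH) T : L T ->
  (forall S, V S -> forall n u, size u = n -> ~ sim (Some u) None -> class_sum n u S = 0) ->
  wot_closure V T -> K T.
Proof.
move=> LT hV cT; split=> // n; apply: span_of_class_sums => u u0.
apply: (wot_closure_eq (@continuous_class_sum n u) (psi := fun=> 0)) cT => [|S VS].
  exact: cst_continuous.
by apply: hV => //; rewrite size_tuple.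
Qed.

Lemma class_sum_component n u T : class_sum n u (component n T) = class_sum n u T.
Proof.
by apply: eq_bigr => w _; rewrite fcoef_component size_tuple eqxx.
Qed.

Lemma graded_span_wot_closed : wot_closure K `<=` K.
Proof.
move=> T cT; apply: graded_span_of_wot_closure (cT).
  by apply: free_algebra_wot_closed; apply: wot_closure_mono cT => S [].
move=> S [_ hS] n u un u0; rewrite -class_sum_component; exact: class_sum_span.
Qed.

Lemma span_creation_comp u S : linear_span D S -> linear_span D (creation u \o S).
Proof.
have [s0 sL] := @linear_span_subspace _ _ D.
move=> /(_ [set S : BH | linear_span D (creation u \o S : BH)]); apply.
  split=> [|c S1 S2 h1 h2] /=.
    rewrite (_ : _ \o _ = 0)//; apply/funext => f /=.
    exact: bounded_op_0 (bounded_creation R u).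
  rewrite (_ : _ \o _ = c *: (creation u \o S1) + (creation u \o S2)); first exact: sL.
  by apply/funext => f /=; rewrite (bounded_opP _ _ _ (bounded_creation R u)).
move=> _ [[a b] /= ab <-]; apply: sub_linear_span.
exists (mulw0 (Some u) a, mulw0 (Some u) b); first exact: sim_mul.
rewrite !creation0_mul; apply/funext => f /=.
by rewrite (bounded_opB _ _ (bounded_creation R u)).
Qed.

Lemma span_comp_creation u S : linear_span D S -> linear_span D (S \o creation u).
Proof.
have [s0 sL] := @linear_span_subspace _ _ D.
move=> /(_ [set S : BH | linear_span D (S \o creation u : BH)]); apply.
  by split=> [//|c S1 S2 h1 h2] /=; exact: sL.
move=> _ [[a b] /= ab <-]; apply: sub_linear_span.
exists (mulw0 a (Some u), mulw0 b (Some u)); first exact: sim_mul.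
by rewrite !creation0_mul.
Qed.

(** A component of a product is a finite sum of products of components, and
    the span of the differences is stable under multiplication by creation
    operators because the relation is a congruence. *)
Lemma graded_span_ideal : ideal K.
Proof.
have sD := @linear_span_subspace _ _ D.
split=> [T []//||A T LA [LT hT]|]; [exact: graded_span_subspace| |exact: graded_span_wot_closed].
split; split; [exact: free_algebra_comp| |exact: free_algebra_comp|] => n.
  rewrite component_comp//; apply: (subspace_sum sD) => i _.
  rewrite (_ : _ \o _ = \sum_(w : i.-tuple 'I_d)
    fcoef A w *: (creation (tval w) \o component (n - i) T)); last first.
    by apply/funext => f; rewrite /= [component i A]/component !opsumE.
  by apply: (subspace_sum sD) => w _; apply: (subspaceZ sD); exact: span_creation_comp.
rewrite component_comp//; apply: (subspace_sum sD) => i _.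
have bT := free_algebra_bounded (free_algebra_component i T).
rewrite (_ : _ \o _ = \sum_(w : (n - i).-tuple 'I_d)
  fcoef A w *: (component i T \o creation (tval w))); last first.
  apply/funext => f; rewrite /= [component (n - i) A]/component !opsumE (bounded_op_sum _ _ _ bT).
  by apply: eq_bigr => w _; rewrite (bounded_opZ _ _ bT).
by apply: (subspace_sum sD) => w _; apply: (subspaceZ sD); exact: span_comp_creation.
Qed.

Lemma graded_span_sub_closure : K `<=` wstar_closure (linear_span D).
Proof.
by move=> T [LT hT]; apply: free_algebra_wstar_span_component => //; exact: linear_span_subspace.
Qed.

Lemma closure_sub_graded_span :
  wstar_closure (linear_span D) `&` L `<=` K.
Proof.
move=> T [/wstar_closure_sub_wot cT LT]; apply: graded_span_of_wot_closure (cT) => //.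
by move=> S hS n u un u0; exact: class_sum_span.
Qed.

Lemma graded_span_homogeneous : homogeneous K.
Proof.
exists (homogeneous_poly (d := d) `&` K); first by move=> T [].
apply/seteqP; split=> [T [LT hT] J' iJ SJ|T]; last first.
  by apply; [exact: graded_span_ideal|move=> S []].
apply: ideal_of_components => // n; apply: SJ; split.
  exact: homogeneous_component.
split; first exact: free_algebra_component.
move=> m; rewrite component_component; case: eqP => // _.
exact: subspace0 (@linear_span_subspace _ _ D).
Qed.

End span.

End congruences.

(** * The comultiplication *)
Section tensors.
Variables (R : realType) (d : nat).
Local Notation C := (Cplx R).
Local Notation word := (word d).
Local Notation word0 := (word0 d).
Local Notation BH := (op R word).
Local Notation BHH := (op R (word * word)%type).
Local Notation L := (free_algebra R d).
Implicit Types (u v w x : word) (a b : word0).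

Lemma tensvE (f g : l2 R word) (q : word * word) : tensv f g q = f q.1 * g q.2.
Proof. by []. Qed.

Lemma is_tensorBl (A A' B : BH) (T T' : BHH) :
  is_tensor A B T -> is_tensor A' B T' -> is_tensor (A - A') B (T - T').
Proof.
move=> [bT hT] [bT' hT']; split.
  by rewrite addrC -scaleN1r; exact: bounded_op_lin.
move=> f g; rewrite opDE opNE hT hT'; apply: l2_ext => q.
by rewrite l2DE l2NE !tensvE opDE opNE l2DE l2NE mulrBl.
Qed.

Lemma is_tensorBr (A B B' : BH) (T T' : BHH) :
  is_tensor A B T -> is_tensor A B' T' -> is_tensor A (B - B') (T - T').
Proof.
move=> [bT hT] [bT' hT']; split.
  by rewrite addrC -scaleN1r; exact: bounded_op_lin.
move=> f g; rewrite opDE opNE hT hT'; apply: l2_ext => q.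
by rewrite l2DE l2NE !tensvE opDE opNE l2DE l2NE mulrBr.
Qed.

Definition strip2 u v (q : word * word) : option (word * word) :=
  if prefix u q.1 && prefix v q.2 then Some (drop (size u) q.1, drop (size v) q.2)
  else None.

Lemma strip2_inj u v (x y z : word * word) : strip2 u v x = Some z -> strip2 u v y = Some z -> x = y.
Proof.
rewrite /strip2; case: x => x1 x2; case: y => y1 y2 /=.
case: ifP => // /andP[/prefixP[s ->] /prefixP[t ->]].
case: ifP => // /andP[/prefixP[s' ->] /prefixP[t' ->]].
by rewrite !drop_size_cat// => -[<-] [-> ->].
Qed.

(** Delta only provides tensor squares; the mixed products of creation
    operators needed for the coideal property are constructed here. *)
Lemma creation0_tensor a b : exists T : BHH, is_tensor (creation0 a) (creation0 b) T.
Proof.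
have tens0 (A B : BH) : (A = 0 \/ B = 0) -> is_tensor A B 0.
  move=> h; split; first exact: bounded_op_cst0.
  move=> f g; apply: l2_ext => q; rewrite tensvE op0E l20E.
  by case: h => ->; rewrite op0E l20E ?mul0r ?mulr0.
case: a b => [u|] [v|] /=; [|by exists 0; apply: tens0; auto..].
exists (pullback (@strip2_inj u v)); split; first exact: (bounded_pullback (@strip2_inj u v)).
move=> f g; apply: l2_ext => q.
rewrite pullbackE tensvE !creationE /strip2.
by case: (prefix u q.1); case: (prefix v q.2) => /=; rewrite ?tensvE ?mul0r ?mulr0.
Qed.

Section comultiplication.
Variable Delta : BH -> BHH.
Hypothesis Delta_comult : comultiplication Delta.

Lemma comult_lin (c : R[i]) S T : L S -> L T ->
  Delta (c *: S + T) = c *: Delta S + Delta T.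
Proof. by case: Delta_comult => _ [_ + _] _ _ _; exact. Qed.

Lemma comult0 : Delta 0 = 0.
Proof.
have L0 := subspace0 (@free_algebra_subspace R d).
by have := comult_lin (-1) L0 L0; rewrite scaler0 addr0 scaleN1r addNr.
Qed.

Lemma comultB S T : L S -> L T -> Delta (S - T) = Delta S - Delta T.
Proof.
by move=> LS LT; rewrite addrC -scaleN1r comult_lin// scaleN1r addrC.
Qed.

Lemma comult_sum (I : Type) (r : seq I) (c : I -> R[i]) (u : I -> BH) :
  (forall i, L (u i)) ->
  Delta (\sum_(i <- r) c i *: u i) = \sum_(i <- r) c i *: Delta (u i).
Proof.
move=> Lu; elim: r => [|i r IH]; first by rewrite !big_nil comult0.
rewrite !big_cons comult_lin ?IH//; apply: (subspace_sum (@free_algebra_subspace R d)) => j _.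
exact: (subspaceZ (@free_algebra_subspace R d)).
Qed.

Lemma comult_creation0 a : is_tensor (creation0 a) (creation0 a) (Delta (creation0 a)).
Proof.
case: a => [u|] /=; first by case: Delta_comult.
rewrite comult0; split; first exact: bounded_op_cst0.
by move=> f g; apply: l2_ext => q; rewrite tensvE op0E l20E mul0r.
Qed.

Lemma comult_bounded T : L T -> bounded_op (Delta T).
Proof. by case: Delta_comult => + _ _ _ _ LT => /(_ _ LT)[]. Qed.

(** Delta is weak* continuous on the algebra only, hence the inclusions. *)
Lemma comult_closure (S : set BH) (Z : set BHH) T : L T -> S `<=` L ->
  wstar_closure S T -> (forall S', S S' -> Z (Delta S')) -> wstar_closure Z (Delta T).
Proof.
move=> LT SL [bT cT] SZ; split; first exact: comult_bounded.
case: Delta_comult => _ _ cD _ _ A /(cD T).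
rewrite /= /nbhs/= -nbhs_subspace_in// => /cT[S' [SS' hS']].
by exists (Delta S'); split; [exact: SZ|apply: hS'; exact: SL].
Qed.

(** On a generator, with [u] and [v] congruent, the value of Delta is
    [L_u (x) L_u - L_v (x) L_v = (L_u - L_v) (x) L_u + L_v (x) (L_u - L_v)];
    the general case follows by linearity and weak* continuity. *)
Lemma coideal_of_differences (sim : word0 -> word0 -> Prop) (J : set BH) :
  J `<=` L -> linear_subspace J -> wstar_closure J `<=` J ->
  J = wstar_closure (linear_span (@differences R d sim)) -> coideal Delta J.
Proof.
move=> JL sJ cJ JE; split=> // T JT.
have DL : linear_span (@differences R d sim) `<=` L by exact: span_L.
have spJ : linear_span (@differences R d sim) `<=` J.
  move=> S hS; rewrite JE; split; first by apply: free_algebra_bounded; exact: DL.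
  exact: (@subset_closure (wstar R word)).
apply: (@comult_closure (linear_span (@differences R d sim))) => //; first exact: JL.
  by rewrite -JE.
pose Z : set BHH := [set S1 + S2 | S1 in alg_tensor J L & S2 in alg_tensor L J].
have sZ : linear_subspace Z.
  have [s10 s1L] := @linear_span_subspace _ _ [set T : BHH | exists A B, [/\ J A, L B & is_tensor A B T]].
  have [s20 s2L] := @linear_span_subspace _ _ [set T : BHH | exists A B, [/\ L A, J B & is_tensor A B T]].
  split; first by exists 0 => //; exists 0 => //; rewrite addr0.
  move=> c _ _ [S1 h1 [S2 h2 <-]] [T1 k1 [T2 k2 <-]].
  exists (c *: S1 + T1); first exact: s1L.
  exists (c *: S2 + T2); first exact: s2L.
  by rewrite scalerDr addrACA.
move=> S' hS'; suff : L S' /\ Z (Delta S') by case.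
move: hS' => /(_ [set S | L S /\ Z (Delta S)]); apply.
  split=> [|c S1 S2 /= [L1 Z1] [L2 Z2]].
    by split; [exact: (subspace0 (@free_algebra_subspace R d))|rewrite comult0; case: sZ].
  split; first by case: (@free_algebra_subspace R d) => _; exact.
  by rewrite comult_lin//; case: sZ => _; exact.
move=> _ [[a b] /= ab <-].
have La := @free_algebra_creation0 R d a; have Lb := @free_algebra_creation0 R d b.
split; first exact: (subspaceB (@free_algebra_subspace R d)).
have Jab : J (creation0 a - creation0 b) by apply: spJ; apply: sub_linear_span; exists (a, b).
have [M hM] := creation0_tensor b a.
rewrite comultB//; exists (Delta (creation0 a) - M).
  apply: sub_linear_span; exists (creation0 a - creation0 b), (creation0 a); split=> //.
  exact: is_tensorBl (comult_creation0 a) hM.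
exists (M - Delta (creation0 b)); last by rewrite addrA subrK.
apply: sub_linear_span; exists (creation0 b), (creation0 a - creation0 b); split=> //.
exact: is_tensorBr hM (comult_creation0 b).
Qed.

End comultiplication.
End tensors.

(** * Separating a vector from a subspace of a finite-dimensional space *)
Section separation.
Variable F : fieldType.

(** A matrix of maximal rank among those with rows in [U] has row space [U], and
    a column of its cokernel separates. *)
Lemma separation_rV m (U : set 'rV[F]_m) (v : 'rV[F]_m) :
  U 0 -> (forall (c : F) x y, U x -> U y -> U (c *: x + y)) -> ~ U v ->
  exists2 c : 'cV[F]_m, (forall x, U x -> x *m c = 0) & v *m c != 0.
Proof.
move=> U0 UL nUv.
pose P r := `[< exists k (M : 'M[F]_(k, m)), (forall i, U (row i M)) /\ \rank M = r >].
have exP : exists r, P r.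
  by exists 0%N; apply/asboolP; exists 0%N, 0; split=> [[]//|]; rewrite mxrank0.
have ubP r : P r -> (r <= m)%N.
  by move=> /asboolP[k [M [_ <-]]]; exact: rank_leq_col.
case: (ex_maxnP exP ubP) => r /asboolP[k [M [UM rM]]] rmax.
have UsubM x : U x -> (x <= M)%MS.
  move=> Ux; have /rmax : P (\rank (col_mx M x)).
    apply/asboolP; exists (k + 1)%N, (col_mx M x); split=> // i.
    case: (splitP i) => j ij.
      by rewrite (_ : i = lshift 1 j) ?rowKu//; exact: val_inj.
    rewrite (_ : i = rshift k j) ?rowKd; last exact: val_inj.
    by rewrite (_ : row j x = x)//; apply/rowP => l; rewrite mxE ord1.
  have Ms : (M <= col_mx M x)%MS by rewrite -addsmxE addsmxSl.
  rewrite -rM => rle; have := mxrank_leqif_sup Ms.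
  rewrite /leqif eqn_leq rle andbT => -[-> /esym]; rewrite -addsmxE addsmx_sub => /andP[_ ->//].
have MsubU x : (x <= M)%MS -> U x.
  move=> /submxP[y ->]; rewrite mulmx_sum_row.
  elim/big_rec: _ => // i z _ Uz; exact: UL.
have : v *m cokermx M != 0 by rewrite -submxE; apply/negP => /MsubU.
move=> /eqP h; have [j hj] : exists j, (v *m cokermx M) 0 j != 0.
  apply: contrapT => hj; apply: h; apply/rowP => j; rewrite [RHS]mxE.
  by apply/eqP; apply: contrapT => /negP nj; apply: hj; exists j.
exists (col j (cokermx M)) => [x /UsubM|].
  by rewrite submxE => /eqP h'; rewrite colE mulmxA h' mul0mx.
by rewrite colE mulmxA -colE; apply: contra hj => /eqP/matrixP/(_ 0 0); rewrite !mxE => ->.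
Qed.

Lemma separation (I : finType) (U : set (I -> F)) (v : I -> F) :
  U (fun=> 0) ->
  (forall (c : F) x y, U x -> U y -> U (fun i => c * x i + y i)) -> ~ U v ->
  exists2 c : I -> F, (forall x, U x -> \sum_i x i * c i = 0) & \sum_i v i * c i != 0.
Proof.
move=> U0 UL nUv; pose fn (x : 'rV[F]_#|I|) : I -> F := fun i => x 0 (enum_rank i).
pose rw (x : I -> F) : 'rV[F]_#|I| := \row_j x (enum_val j).
have rwK x : fn (rw x) = x by apply/funext => i; rewrite /fn mxE enum_rankK.
have [] := @separation_rV #|I| [set x | U (fn x)] (rw v).
- by rewrite /= (_ : fn 0 = fun=> 0)//; apply/funext => i; rewrite /fn mxE.
- move=> c x y /= Ux Uy; rewrite (_ : fn _ = fun i => c * fn x i + fn y i).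
    exact: UL.
  by apply/funext => i; rewrite /fn !mxE.
- by rewrite /= rwK.
move=> c hc hv; exists (fun i => c (enum_rank i) 0).
  move=> x Ux; have := hc (rw x); rewrite /= rwK => /(_ Ux)/matrixP/(_ 0 0).
  rewrite [RHS]mxE mxE => E; rewrite -[RHS]E (reindex (@enum_rank I))/=; last first.
    by exists enum_val => i _; [exact: enum_rankK|exact: enum_valK].
  by apply: eq_bigr => i _; rewrite mxE enum_rankK.
apply: contra hv => /eqP h; apply/eqP/matrixP => a b.
rewrite !ord1 [RHS]mxE -[RHS]h mxE (reindex (@enum_rank I))/=; last first.
  by exists enum_val => i _; [exact: enum_rankK|exact: enum_valK].
by apply: eq_bigr => i _; rewrite mxE enum_rankK.
Qed.

End separation.

(** * The congruence of a homogeneous Hopf ideal *)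
Section hopf_ideal.
Variables (R : realType) (d : nat).
Local Notation C := (Cplx R).
Local Notation word := (word d).
Local Notation word0 := (word0 d).
Local Notation BH := (op R word).
Local Notation BHH := (op R (word * word)%type).
Local Notation L := (free_algebra R d).
Implicit Types (u v w x : word) (a b : word0) (S T : BH).

Lemma dotl2_suml (X : choiceType) (I : Type) (r : seq I) (c : I -> R[i])
    (h : I -> l2 R X) (g : l2 R X) :
  dotl2 (\sum_(i <- r) c i *: h i) g = \sum_(i <- r) c i * dotl2 (h i) g.
Proof.
elim: r => [|i r IH]; last by rewrite !big_cons dotl2Dl IH.
rewrite !big_nil; apply/eqP; rewrite -normr_le0; apply: dotl2_le => F.
by rewrite big1 ?normr0// => i _; rewrite l20E mul0r.
Qed.

(** Taking a homogeneous component is weakly continuous, being given by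
    finitely many coefficients. *)
Lemma component_wot_closure n (V : set BH) T :
  wot_closure V T -> wot_closure (component n @` V) (component n T).
Proof.
move=> [bT cT]; split; first exact: free_algebra_bounded (free_algebra_component n T).
have cn : component n @ (T : wot R word) --> (component n T : wot R word).
  apply: (@cvg_initial_ptws _ _ _ (@wot_eval R word)
    (component n @ (T : wot R word)) (fmap_filter _ (@nbhs_filter (wot R word) T))) => -[f g].
  have E S : wot_eval (component n S) (f, g) =
      \sum_(w : n.-tuple 'I_d) (fcoef S w : C) * dotl2 (creation (tval w) f) g.
    by rewrite /wot_eval/= /component opsumE dotl2_suml.
  have h : (wot_eval (component n S) (f, g) : C) @[S --> (T : wot R word)]
      --> (wot_eval (component n T) (f, g) : C).
    rewrite (_ : (fun S => _) = (fun S => \sum_(w : n.-tuple 'I_d)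
      (fcoef S w : C) * dotl2 (creation (tval w) f) g : C)); last exact/funext/E.
    by rewrite E; apply: (@continuous_lincomb R (wot R word)) => w; exact: continuous_wot_coord.
  exact: h.
have VV S : V S -> (component n @` V) (component n S) by move=> VS; exists S.
exact: (@closure_image (wot R word) (wot R word) (component n) V _ T cn VV cT).
Qed.

(** The elements of [J] whose components all belong to [J] form a weakly closed
    ideal, and it contains the homogeneous generators. *)
Lemma homogeneous_ideal_component (J : set BH) n T :
  homogeneous J -> ideal J -> J T -> J (component n T).
Proof.
move=> [S Sh JE] iJ JT; have [JL sJ mJ cJ] := iJ.
have SJ : S `<=` J by move=> U SU; rewrite JE => J' _; apply.
suff : [set T | J T /\ forall n, J (component n T)] T by case.
move: JT; rewrite {1}JE; apply; last first.
  move=> U SU; split=> [|m]; first exact: SJ.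
  by case: (component_homogeneous_poly m (Sh _ SU)) => ->; [exact: SJ|exact: subspace0 sJ].
split=> [U [/JL]//||A U LA [JU hU]|U cU].
- split=> [|c U V [JU hU] [JV hV]].
    by split=> [|m]; rewrite ?component0; exact: subspace0 sJ.
  by split=> [|m]; rewrite ?component_lin; case: sJ => _; exact.
- have LU := JL _ JU; split; split=> [|m]; [by case: (mJ _ _ LA JU)| |by case: (mJ _ _ LA JU)|].
    rewrite component_comp//; apply: (subspace_sum sJ) => i _.
    by case: (mJ _ _ (free_algebra_component i A) (hU (m - i)%N)).
  rewrite component_comp//; apply: (subspace_sum sJ) => i _.
  by case: (mJ _ _ (free_algebra_component (m - i) A) (hU i)).
- split; first by apply: cJ; apply: wot_closure_mono cU => V [].
  move=> m; apply: cJ; apply: wot_closure_mono (component_wot_closure m cU).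
  by move=> _ [V [_ hV] <-].
Qed.

Section congruence_of_ideal.
Variable J : set BH.
Hypotheses (iJ : ideal J) (hJ : homogeneous J).

Let JL : J `<=` L. Proof. by case: iJ. Qed.
Let sJ : linear_subspace J. Proof. by case: iJ. Qed.

Definition ideal_rel a b : Prop := J (creation0 a - creation0 b).
Local Notation sim := ideal_rel.

Lemma component_creation n u :
  component n (creation u) = if size u == n then creation u else 0 :> BH.
Proof.
apply: free_algebra_ext => [||w]; first exact: free_algebra_component.
  by case: ifP => _; [exact: free_algebra_creation|exact: (subspace0 (@free_algebra_subspace R d))].
rewrite fcoef_component fcoef_creation.
case: (eqVneq w u) => [->|wu]; first by case: ifP; rewrite ?fcoef_creation ?eqxx.
by case: (size u == n); rewrite ?fcoef_creation ?(negbTE wu); case: ifP.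
Qed.

(** Homogeneity: if [L_u - L_v] is in [J] and the lengths differ, then both
    [L_u] and [L_v], up to sign its homogeneous components, are in [J]. *)
Lemma ideal_rel_congruence : homogeneous_congruence sim.
Proof.
have sym a b : sim a b -> sim b a.
  by move=> ab; rewrite /ideal_rel -opprB -scaleN1r; exact: (subspaceZ sJ).
split; first split.
- split=> [a|a b|a b c ab bc]; first by rewrite /ideal_rel subrr; exact: subspace0 sJ.
    exact: sym.
  rewrite /ideal_rel -[_ - _](_ : (creation0 a - creation0 b) + (creation0 b - creation0 c) = _).
    exact: (subspaceD sJ).
  by rewrite addrA subrK.
- move=> a a' b b' aa bb; rewrite /ideal_rel !creation0_mul.
  have [_ _ mJ _] := iJ.
  rewrite (_ : _ - _ = (creation0 a \o (creation0 b - creation0 b')) +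
     ((creation0 a - creation0 a') \o creation0 b')).
    apply: (subspaceD sJ); first by case: (mJ _ _ (@free_algebra_creation0 R d a) bb).
    by case: (mJ _ _ (@free_algebra_creation0 R d b') aa).
  apply/funext => f.
  rewrite [RHS](_ : _ = creation0 a (creation0 b f - creation0 b' f) +
    (creation0 a (creation0 b' f) - creation0 a' (creation0 b' f)))//.
  by rewrite (bounded_opB _ _ (free_algebra_bounded (@free_algebra_creation0 R d a))) addrA subrK.
- move=> u v uv nz; apply: contrapT => suv.
  have cE n : component n (creation u - creation v) =
      (if size u == n then creation u else 0) - (if size v == n then creation v else 0) :> BH.
    by rewrite addrC -scaleN1r component_lin !component_creation scaleN1r addrC.
  have Ju : J (creation u).
    have := homogeneous_ideal_component (size u) hJ iJ uv.
    by rewrite /= cE eqxx; case: eqP => [E|_]; [case: suv|rewrite subr0].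
  have Jv : J (creation v).
    have := homogeneous_ideal_component (size v) hJ iJ uv.
    rewrite /= cE eqxx; case: eqP => [//|_]; rewrite sub0r => h.
    by rewrite -[creation v]opprK -scaleN1r; exact: (subspaceZ sJ).
  by case: nz; apply; rewrite /ideal_rel/= subr0.
Qed.

Section annihilator.
Variables (Delta : BH -> BHH) (Delta_comult : comultiplication Delta).
Hypothesis cJ : coideal Delta J.
Variable n : nat.
Local Notation I := (n.-tuple 'I_d).

(** The linear functionals on polynomials of degree [n], given by their values
    on words, that vanish on the part of [J] of degree [n]. *)
Definition annihilator : set (I -> R[i]) :=
  [set phi | forall T, J T -> \sum_(w : I) fcoef T w * phi w = 0].
Local Notation W := annihilator.

Lemma annihilator_lin (c : R[i]) phi psi :
  W phi -> W psi -> W (fun w : I => c * phi w + psi w).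
Proof.
move=> hphi hpsi T JT; under eq_bigr do rewrite mulrDr mulrCA.
by rewrite big_split/= -mulr_sumr hphi// hpsi// mulr0 addr0.
Qed.

Lemma sum_fcoef_creation (w : I) (chi : I -> R[i]) :
  \sum_(v : I) fcoef (creation (tval w)) v * chi v = chi w.
Proof.
rewrite (bigD1 w)//= fcoef_creation eqxx mul1r big1 ?addr0// => v vw.
by rewrite fcoef_creation val_eqE (negbTE vw) mul0r.
Qed.

(** The coideal property says that the annihilator is closed under the
    pointwise product.  The functional [phi (x) psi] is a combination of
    matrix coefficients, hence weakly continuous; it kills
    [J (x) L + L (x) J], and on [Delta T] it takes the value of [phi * psi]
    at [T] because [Delta L_w = L_w (x) L_w]. *)
Lemma annihilator_mul phi psi : W phi -> W psi -> W (fun w : I => phi w * psi w).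
Proof.
move=> hphi hpsi T JT.
pose xi : l2 R (word * word)%type := tensv (basisv R [::]) (basisv R [::]).
pose Phi (S : BHH) : C :=
  \sum_(q : I * I) (S xi (tval q.1, tval q.2) : C) * (phi q.1 * psi q.2).
have PhiE (A B : BH) (S : BHH) : is_tensor A B S ->
    Phi S = (\sum_(w : I) fcoef A w * phi w) * (\sum_(w : I) fcoef B w * psi w).
  move=> [_ hS]; rewrite /Phi hS mulr_suml.
  under [RHS]eq_bigr do rewrite mulr_sumr.
  rewrite pair_big/=; apply: eq_bigr => -[u v] _ /=.
  by rewrite mulrACA.
have Phi_lin (c : R[i]) (S S' : BHH) : Phi (c *: S + S') = c * Phi S + Phi S'.
  rewrite /Phi mulr_sumr -big_split/=; apply: eq_bigr => q _.
  by rewrite [c * _]mulrA -mulrDl.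
have Phi0 : Phi 0 = 0 by rewrite /Phi big1// => q _; rewrite op0E l20E mul0r.
have PhiD (S S' : BHH) : Phi (S + S') = Phi S + Phi S'.
  by have := Phi_lin 1 S S'; rewrite scale1r mul1r.
have PhiS (V : set BHH) : (forall S : BHH, V S -> Phi S = 0) ->
    forall S : BHH, linear_span V S -> Phi S = 0.
  move=> hV S /(_ [set S | Phi S = 0]); apply=> //; split=> // c S1 S2 /= h1 h2.
  by rewrite Phi_lin h1 h2 mulr0 addr0.
have JnT : J (component n T) by exact: homogeneous_ideal_component.
have [_ _ _ /(_ _ JnT)] := cJ.
move=> /wstar_closure_sub_wot/(@wot_closure_eq _ _ _ Phi (fun=> 0)) PhiDelta.
have : Phi (Delta (component n T)) = 0.
  apply: PhiDelta.
  - by apply: continuous_lincomb => q; exact: continuous_wot_coord.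
  - exact: cst_continuous.
  - move=> _ [S1 h1 [S2 h2 <-]]; rewrite PhiD.
    rewrite (PhiS _ _ _ h1) ?(PhiS _ _ _ h2) ?addr0//.
      by move=> S [A [B [_ JB hS]]]; rewrite (PhiE _ _ _ hS) (hpsi _ JB) mulr0.
    by move=> S [A [B [JA _ hS]]]; rewrite (PhiE _ _ _ hS) (hphi _ JA) mul0r.
rewrite /component (comult_sum Delta_comult); last by move=> w; exact: free_algebra_creation.
have PhiZ (c : R[i]) (S : BHH) : Phi (c *: S) = c * Phi S.
  by have := Phi_lin c S 0; rewrite addr0 Phi0 addr0.
have -> : Phi (\sum_(w : I) fcoef T w *: Delta (creation w)) =
    \sum_(w : I) fcoef T w * Phi (Delta (creation w)).
  elim: (index_enum _) => [|w s IH]; first by rewrite !big_nil.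
  by rewrite !big_cons PhiD PhiZ IH.
move=> E; rewrite -[RHS]E; apply: eq_bigr => w _.
have [_ _ _ _ /(_ (tval w)) hw] := Delta_comult.
by rewrite (PhiE _ _ _ hw) !sum_fcoef_creation.
Qed.

Lemma annihilator_separates (p : I -> R[i]) :
  ~ J (\sum_(w : I) p w *: creation (tval w)) ->
  exists2 phi, W phi & \sum_(w : I) p w * phi w != 0.
Proof.
move=> nJ; pose U : set (I -> R[i]) := [set p | J (\sum_(w : I) p w *: creation (tval w))].
have [||phi hphi pphi] := @separation _ _ U p _ _ nJ.
- rewrite /U/= big1; first exact: subspace0 sJ.
  by move=> w _; rewrite scale0r.
- move=> c x y /= Ux Uy.
  rewrite /U/= (_ : \sum_w _ = c *: (\sum_(w : I) x w *: creation (tval w)) +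
     \sum_(w : I) y w *: creation (tval w)).
    by case: sJ => _; exact.
  rewrite scaler_sumr -big_split/=; apply: eq_bigr => w _.
  by rewrite scalerDl scalerA.
exists phi => // T JT; apply: hphi.
exact: homogeneous_ideal_component.
Qed.

Lemma annihilator_invariant phi (u w : I) : W phi ->
  sim (Some (tval u)) (Some (tval w)) -> phi u = phi w.
Proof.
move=> hphi /hphi /=; rewrite addrC -scaleN1r.
under eq_bigr do rewrite fcoef_lin mulrDl -mulrA.
rewrite big_split/= -mulr_sumr !sum_fcoef_creation mulN1r addrC => /eqP.
by rewrite subr_eq0 => /eqP.
Qed.

Lemma sum_delta_creation (u : I) :
  \sum_(w : I) (w == u)%:R *: creation (tval w) = creation (tval u) :> BH.
Proof.
rewrite (bigD1 u)//= eqxx scale1r big1 ?addr0// => w /negbTE ->.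
by rewrite scale0r.
Qed.

Lemma annihilator_separates_word (u : I) : ~ sim (Some (tval u)) None ->
  exists2 psi, W psi & psi u != 0.
Proof.
move=> u0; have [|psi Wpsi] := @annihilator_separates (fun w : I => (w == u)%:R).
  by rewrite sum_delta_creation => Ju; apply: u0; rewrite /ideal_rel/= subr0.
rewrite (bigD1 u)//= eqxx mul1r big1 ?addr0 => [|w /negbTE ->]; last by rewrite mul0r.
by exists psi.
Qed.

Lemma annihilator_separates_words (u w : I) :
  ~ sim (Some (tval u)) (Some (tval w)) -> exists2 phi, W phi & phi u - phi w != 0.
Proof.
move=> uw; pose p (v : I) : R[i] := (v == u)%:R - (v == w)%:R.
have pE (X : lmodType R[i]) (f : I -> X) :
    \sum_(v : I) p v *: f v = f u - f w.
  under eq_bigr do rewrite scalerBl.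
  rewrite big_split/= sumrN (bigD1 u)//= eqxx scale1r big1 ?addr0 => [|v /negbTE ->]; last by rewrite scale0r.
  rewrite (bigD1 w)//= eqxx scale1r big1 ?addr0// => v /negbTE ->.
  by rewrite scale0r.
have [|phi Wphi] := @annihilator_separates p; first by rewrite pE.
by rewrite (pE R[i]^o phi); exists phi.
Qed.

(** A subalgebra of the functions on a finite set contains the indicator of
    each class of points that it does not separate, except the class on which
    it vanishes: multiply the functions that separate [u] from the words
    outside of its class. *)
Lemma annihilator_indicator (u : I) : ~ sim (Some (tval u)) None ->
  exists2 chi, W chi &
    forall w : I, chi w = `[< sim (Some (tval u)) (Some (tval w)) >]%:R.
Proof.
move=> u0; have [psi Wpsi psiu] := annihilator_separates_word u0.
have [chi [Wchi chiu chi0]] : exists chi, [/\ W chi, chi u = 1 &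
    forall w : I, w \in enum {: I} -> ~ sim (Some (tval u)) (Some (tval w)) -> chi w = 0].
  elim: (enum {: I}) => [|w s [chi [Wchi chiu chi0]]].
    exists (fun w : I => (psi u)^-1 * psi w + 0); split=> //.
      by apply: annihilator_lin => // T _; rewrite big1// => w _; rewrite mulr0.
    by rewrite addr0 mulVf.
  have [uw|uw] := pselect (sim (Some (tval u)) (Some (tval w))).
    exists chi; split=> // v; rewrite inE => /predU1P[->//|]; exact: chi0.
  have [phi Wphi phiuw] := annihilator_separates_words uw.
  (* The constant function [phi w] need not annihilate [J], so the factor
     [phi - phi w] is only available multiplied by [chi]. *)
  pose k := (phi u - phi w)^-1.
  exists (fun v : I => k * (chi v * phi v) + ((- (k * phi w)) * chi v + 0)); split.
  - apply: annihilator_lin; first exact: annihilator_mul.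
    by apply: annihilator_lin => // T _; rewrite big1// => v _; rewrite mulr0.
  - by rewrite chiu addr0 mulr1 mul1r -mulrBr mulVf.
  - move=> v; rewrite inE addr0 => /predU1P[-> _|vs uv]; first by ring.
    by rewrite chi0// mul0r !mulr0 addr0.
exists chi => // w; case: asboolP => uw; last by rewrite chi0 ?mem_enum.
by rewrite -(annihilator_invariant Wchi uw).
Qed.

Lemma class_sum_ideal (u : I) T : ~ sim (Some (tval u)) None -> J T ->
  class_sum sim n u T = 0.
Proof.
move=> /annihilator_indicator[chi Wchi chiE] JT; rewrite -(Wchi T JT).
by apply: eq_bigr => w _; rewrite chiE.
Qed.

End annihilator.
End congruence_of_ideal.
End hopf_ideal.

Theorem theorem3p4 (R : realType) (d : nat) (d_gt0 : (0 < d)%N)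
    (Delta : op R (word d) -> op R (word d * word d)%type)
    (Delta_comult : comultiplication Delta)
    (J : set (op R (word d))) (JL : J `<=` free_algebra R d) :
  (homogeneous J /\ hopf_ideal Delta J) <->
  (exists2 sim : word0 d -> word0 d -> Prop, homogeneous_congruence sim &
     J = wstar_closure (linear_span
       [set creation0 p.1 - creation0 p.2 | p in [set p | sim p.1 p.2]])).
Proof.
split=> [[hJ [iJ cJ]]|[sim sim_cong JE]].
  have sim_cong := ideal_rel_congruence iJ hJ.
  exists (ideal_rel J) => //; apply/seteqP; split=> T.
    move=> JT; apply: graded_span_sub_closure; split; first exact: JL.
    move=> n; apply: (span_of_class_sums sim_cong) => u u0.
    exact: (class_sum_ideal iJ hJ Delta_comult cJ).
  have [_ sJ cwJ _] := cJ; move=> hT; apply: cwJ; move: T hT.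
  apply: wstar_closure_mono => T; apply => //.
  by move=> _ [[a b] /= ab <-].
have JK : J = @graded_span R d sim.
  rewrite JE; apply/seteqP; split=> T hT; last exact: graded_span_sub_closure.
  by apply: closure_sub_graded_span => //; split=> //; apply: JL; rewrite JE.
have iJ : ideal J by rewrite JK; exact: graded_span_ideal.
split; first by rewrite JK; exact: graded_span_homogeneous.
have [_ sJ _ cJ] := iJ; split=> //.
apply: (coideal_of_differences Delta_comult JL sJ _ JE).
by move=> T /wstar_closure_sub_wot; exact: cJ.
Qed.
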